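(* Let $h$ be a quasi-homogeneous polynomial of degree $\delta$ on $\mathbb C^2$ (with respect to $R=p_1x\partial_x+p_2y\partial_y$) with an isolated singularity at $0$, and let $X_0=\delta^{-1}(h_y\partial_x-h_x\partial_y)$, viewed as a derivation of $\mathcal O_2$. Let $J_0=(h_x,h_y)\subset\mathcal O_2$ and let $a_1=1,a_2,\dots,a_\mu$ be elements whose classes form a basis of the vector space $\mathcal O_2/J_0$. Then the kernel $\mathrm{Ker}(X_0)$ is the ring $\mathbb C\{h\}$ of first integrals of $X_0$, and the cokernel $\mathcal O_2/\mathrm{Im}(X_0)$ is the free $\mathbb C\{h\}$-module of rank $\mu$ generated by (the classes of) $a_1,a_2,\dots,a_\mu$. The analogous result holds for the derivation $X_0$ acting on the ring of formal series $\widehat{\mathcal O}_2$, with $\mathbb C\{h\}$ replaced by $\mathbb C[[h]]$.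
   Context: $\mathcal O_2=\mathbb C\{x,y\}$ is the ring of germs of holomorphic functions at $0\in\mathbb C^2$, $\widehat{\mathcal O}_2=\mathbb C[[x,y]]$. $p_1,p_2$ are relatively prime positive integers, and $h$ quasi-homogeneous of degree $\delta$ means $R(h)=\delta h$. $\mathbb C\{h\}$ (resp. $\mathbb C[[h]]$) denotes the ring of series $l(h)$ with $l$ a convergent (resp. formal) power series in one variable; multiplication by it commutes with $X_0$, so the cokernel is a module over it. *)

(* Defs.v *)
From HB Require Import structures.
From mathcomp Require Import all_boot all_order all_algebra.
From mathcomp Require Import all_classical all_reals all_analysis.
From mathcomp Require Import complex.
Set Implicit Arguments.
Unset Strict Implicit.
Unset Printing Implicit Defensive.
Import Order.TTheory GRing.Theory Num.Theory.
Local Open Scope classical_set_scope.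
Local Open Scope ring_scope.

(* Formal power series in one variable; a bivariate series is a series in x    *)
(* whose coefficients are series in y, the convention of polyXY for            *)
(* {poly {poly A}}: the coefficient of x^i y^j in f is f i j.                  *)
Record fps (A : Type) := Fps { fps_coef :> nat -> A }.

Notation fps2 A := (fps (fps A)).

HB.instance Definition _ (A : Type) := gen_eqMixin (fps A).
HB.instance Definition _ (A : Type) := gen_choiceMixin (fps A).

Lemma fpsP (A : Type) (f g : fps A) : (forall n, f n = g n) -> f = g.
Proof. by case: f g => [f] [g] /= fg; congr Fps; apply/funext. Qed.

Section FpsZmodule.
Variable A : zmodType.
Implicit Types f g k : fps A.

Definition fps_zero : fps A := Fps (fun=> 0).
Definition fps_opp f : fps A := Fps (fun n => - f n).
Definition fps_add f g : fps A := Fps (fun n => f n + g n).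

Lemma fps_addA : associative fps_add.
Proof. by move=> f g k; apply: fpsP => n /=; rewrite addrA. Qed.
Lemma fps_addC : commutative fps_add.
Proof. by move=> f g; apply: fpsP => n /=; rewrite addrC. Qed.
Lemma fps_add0 : left_id fps_zero fps_add.
Proof. by move=> f; apply: fpsP => n /=; rewrite add0r. Qed.
Lemma fps_addN : left_inverse fps_zero fps_opp fps_add.
Proof. by move=> f; apply: fpsP => n /=; rewrite addNr. Qed.

HB.instance Definition _ :=
  GRing.isZmodule.Build (fps A) fps_addA fps_addC fps_add0 fps_addN.

End FpsZmodule.

Definition fps_const (A : nmodType) (c : A) : fps A :=
  Fps (fun n => if n is 0 then c else 0).

Section FpsRing.
Variable A : comNzRingType.
Implicit Types f g k : fps A.

Definition fps_one : fps A := fps_const 1.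
Definition fps_mul f g : fps A :=
  Fps (fun n => \sum_(i < n.+1) f i * g (n - i)%N).

Lemma fps_mulC : commutative fps_mul.
Proof.
move=> f g; apply: fpsP => n /=.
rewrite (reindex_inj rev_ord_inj) /=; apply: eq_bigr => i _.
by rewrite mulrC subSS subKn // -ltnS.
Qed.

(* The first n coefficients of a product are those of the truncations. *)
Lemma fps_mul_trunc f g n m : (n < m)%N ->
  fps_mul f g n = ((\poly_(i < m) f i) * (\poly_(i < m) g i))`_n.
Proof.
move=> nm; rewrite coefM /=; apply: eq_bigr => i _.
rewrite !coef_poly (leq_ltn_trans _ nm) ?(leq_ltn_trans _ nm) ?leq_subr //.
by rewrite -ltnS.
Qed.

Lemma fps_mulA : associative fps_mul.
Proof.
move=> f g k; apply: fpsP => n.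
pose t (s : fps A) := \poly_(i < n.+1) s i.
transitivity ((t f * (t g * t k))`_n).
  rewrite coefM /=; apply: eq_bigr => i _.
  rewrite coef_poly ltn_ord; congr (_ * _).
  by apply: fps_mul_trunc; rewrite ltnS leq_subr.
rewrite mulrA coefM /=; apply: eq_bigr => i _.
rewrite [in LHS]coef_poly ltnS leq_subr; congr (_ * _).
by apply/esym/fps_mul_trunc/ltn_ord.
Qed.

Lemma fps_mul1 : left_id fps_one fps_mul.
Proof.
move=> f; apply: fpsP => n /=.
rewrite big_ord_recl /= subn0 mul1r big1 ?addr0 // => i _.
by rewrite mul0r.
Qed.

Lemma fps_mulDl : left_distributive fps_mul (@fps_add A).
Proof.
move=> f g k; apply: fpsP => n /=; rewrite -big_split /=.
by apply: eq_bigr => i _; rewrite mulrDl.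
Qed.

Lemma fps_oner_neq0 : fps_one != 0 :> fps A.
Proof.
by apply/eqP => /(congr1 (fun f : fps A => f 0%N)) /= /eqP; rewrite oner_eq0.
Qed.

HB.instance Definition _ := GRing.Zmodule_isComNzRing.Build (fps A)
  fps_mulA fps_mulC fps_mul1 fps_mulDl fps_oner_neq0.

End FpsRing.

Definition fps_deriv (A : nzRingType) (f : fps A) : fps A :=
  Fps (fun n => f n.+1 *+ n.+1).

Definition fps_of_poly (A : nzSemiRingType) (p : {poly A}) : fps A :=
  Fps (fun n => p`_n).

Section Bivariate.
Variable K : comNzRingType.

Definition ser_x (f : fps2 K) : fps2 K := fps_deriv f.
Definition ser_y (f : fps2 K) : fps2 K := Fps (fun i => fps_deriv (f i)).

Definition pol_x (h : {poly {poly K}}) : {poly {poly K}} := h^`().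
Definition pol_y (h : {poly {poly K}}) : {poly {poly K}} := map_poly deriv h.

Definition ser_of_pol (h : {poly {poly K}}) : fps2 K :=
  Fps (fun i => fps_of_poly h`_i).

Lemma ser_x_of_pol h : ser_x (ser_of_pol h) = ser_of_pol (pol_x h).
Proof.
apply: fpsP => i; apply: fpsP => j /=.
rewrite /pol_x coef_deriv coefMn.
have coefMS n (f : fps K) : (f *+ n) j = f j *+ n.
  by elim: n => [|n IH] //; rewrite !mulrS /= -IH.
by rewrite coefMS.
Qed.

Lemma ser_y_of_pol h : ser_y (ser_of_pol h) = ser_of_pol (pol_y h).
Proof.
apply: fpsP => i; apply: fpsP => j /=.
by rewrite /pol_y coef_map_id0 ?deriv0 // coef_deriv.
Qed.

Definition ser_const (c : K) : fps2 K := fps_const (fps_const c).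

(* The series l(h) = \sum_n l_n h^n, for h without constant term: then h ^+ n  *)
(* has order at least n, so that only the n <= i + j contribute to x^i y^j.    *)
Definition ser_comp (l : fps K) (h : fps2 K) : fps2 K :=
  Fps (fun i => Fps (fun j => \sum_(n < (i + j).+1) l n * (h ^+ n) i j)).

(* R(h) = delta h, with R = p1 x d/dx + p2 y d/dy *)
Definition quasi_homogeneous (p1 p2 : nat) (delta : K) (h : {poly {poly K}}) :=
  ('X * pol_x h) *+ p1 + ('Y * pol_y h) *+ p2 = delta%:P%:P * h.

End Bivariate.

Section QuotientModule.
Variable B : comNzRingType.
Implicit Types A S N : set B.

Definition is_submodule S N : Prop :=
  [/\ N 0, (forall f g, N f -> N g -> N (f + g))
         & (forall c f, S c -> N f -> N (c * f))].

(* The classes of the a_i, which belong to A, form a basis of the S-module A/N. *)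
Definition quotient_basis A S N (mu : nat) (a : 'I_mu -> B) : Prop :=
  [/\ (forall i, A (a i)),
      (forall f, A f -> exists2 c : 'I_mu -> B,
         (forall i, S (c i)) & N (f - \sum_i c i * a i))
    & (forall c : 'I_mu -> B, (forall i, S (c i)) ->
         N (\sum_i c i * a i) -> forall i, c i = 0)].

Definition ideal_gen2 A (u v : B) : set B :=
  [set f | exists b c, [/\ A b, A c & f = b * u + c * v]].

End QuotientModule.

Section Convergence.
Variable R : realType.
Local Notation C := R[i].

(* C{t} and C{x,y}: absolute convergence on some disc, resp. bidisc, around 0. *)
(* The norm of R[i] is R[i]-valued; its real part is the usual modulus.         *)
Definition convergent1 : set (fps C) :=
  [set l : fps C | exists2 r : R, 0 < r &
     summable [set: nat] (fun n => (complex.Re `|l n| * r ^+ n)%:E)].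

Definition convergent2 : set (fps2 C) :=
  [set f : fps2 C | exists2 r : R, 0 < r &
     summable [set: nat * nat]
       (fun n => (complex.Re `|f n.1 n.2| * r ^+ (n.1 + n.2))%:E)].

Definition isolated_singularity (h : {poly {poly C}}) : Prop :=
  (pol_x h).[0, 0] = 0 /\ (pol_y h).[0, 0] = 0 /\
  exists2 e : R, 0 < e & forall x y : C, complex.Re `|x| < e ->
    complex.Re `|y| < e ->
    (pol_x h).[x, y] = 0 -> (pol_y h).[x, y] = 0 -> x = 0 /\ y = 0.

Section HamiltonianField.
Variables (h : {poly {poly C}}) (delta : C).

Definition X0 (f : fps2 C) : fps2 C :=
  ser_const delta^-1 *
    (ser_of_pol (pol_y h) * ser_x f - ser_of_pol (pol_x h) * ser_y f).

Definition series_in (L : set (fps C)) : set (fps2 C) :=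
  [set ser_comp l (ser_of_pol h) | l in L].

Definition ker_X0 (A : set (fps2 C)) : set (fps2 C) :=
  [set f | A f /\ X0 f = 0].

Definition im_X0 (A : set (fps2 C)) : set (fps2 C) := [set X0 f | f in A].

Definition J0 (A : set (fps2 C)) : set (fps2 C) :=
  ideal_gen2 A (ser_of_pol (pol_x h)) (ser_of_pol (pol_y h)).

(* The conclusion for X0 acting on the ring A of series in x, y, where L is    *)
(* the matching ring of series in one variable.                                *)
Definition kernel_and_cokernel (A : set (fps2 C)) (L : set (fps C)) : Prop :=
  (ker_X0 A = series_in L /\ subring_closed (mem (series_in L))) /\
  (forall (mu : nat) (mu_gt0 : (0 < mu)%N) (a : 'I_mu -> fps2 C),
     quotient_basis A (range (@ser_const C)) (J0 A) a ->
     a (Ordinal mu_gt0) = 1 ->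
     is_submodule (series_in L) (im_X0 A) /\
     quotient_basis A (series_in L) (im_X0 A) a).

End HamiltonianField.
End Convergence.

(* Main.v *)
Require Import Defs.
From HB Require Import structures.
From mathcomp Require Import all_boot all_order all_algebra.
From mathcomp Require Import all_classical all_reals all_analysis.
From mathcomp Require Import complex ring lra zify.
Set Implicit Arguments.
Unset Strict Implicit.
Unset Printing Implicit Defensive.
Import Order.TTheory GRing.Theory Num.Theory.
Local Open Scope classical_set_scope.
Local Open Scope ring_scope.

(** By isolatedness h_x(t,1), h_y(t,1) have no common root, and homogenizing a
    Bezout relation puts some x^N and y^N in J_0 = (h_x, h_y); in particular
    h_x, h_y is a regular sequence.  Write {h, f} = h_y f_x - h_x f_y, which is
    delta X_0(f), and R for the Euler field, so that
    (R + p1 + p2) {h, f} = {h, (R + delta) f}.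

    - If {h, f} = 0 then df = k dh for some k, and since R + delta is invertible
      f = f(0) + h f' with {h, f'} = 0; iterating, f is a series in h.
    - If h f = {h, g}, the same division gives (R + p1 + p2) f = {h, k}, hence f
      lies in Im(X_0): the cokernel is h-torsion free.  As h and Im(X_0) lie in
      J_0, a relation between the a_i over C[[h]] has zero constant terms, and
      division by h kills it.
    - By Cartan's formula J_0 = Im(X_0) + (h), so that every f is
      sum_i c_i a_i + X_0(g) + h f_1.  The c_i, g and f_1 can be chosen as linear
      operators of f, bounded on a small polydisc; iterating on f_1, the series
      sum_n h^n(...) converge on a smaller one, where h is small. *)

(** * Formal power series *)

(** The obstacle is convergence: the division f = sum_i c_i a_i + {h, g} + h f_1 is repeated
    infinitely often, so each round may cost only a constant factor on one fixed polydisc. The basis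
    hypothesis provides quotients for each series without any control. It is therefore applied only
    to the monomials x^i y^j with i, j < N; all others are divided through x^N and y^N, whose
    cofactors are polynomials. Moreover f_1 contains derivatives, which are unbounded at fixed
    radius; they occur only after some (R + c)^-1, which divides the coefficient of x^i y^j by p1 i
    + p2 j + c and so absorbs the factor i or j. The kernel needs no such estimate: f = l(h) holds
    formally, and the growth of l is read off the coefficients of f along the powers of a single
    monomial. That delta is a positive integer is not assumed: it is the weight of a nonconstant
    monomial of h, which exists because the singularity is isolated. This makes the operators R + c
    with c > 0 diagonal with positive eigenvalues. The convergent and the formal statement share one
    proof, over an abstract pair of rings. *)

Section FpsBasics.
Variable A : comNzRingType.
Implicit Types f g : fps A.

Lemma coef_fpsD f g n : (f + g) n = f n + g n.
Proof. by []. Qed.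

Lemma coef_fpsM f g n : (f * g) n = \sum_(i < n.+1) f i * g (n - i)%N.
Proof. by []. Qed.

Lemma coef_fps_sum (I : Type) (r : seq I) (P : pred I) (F : I -> fps A) n :
  (\sum_(i <- r | P i) F i) n = \sum_(i <- r | P i) F i n.
Proof. exact: (big_morph (fun f : fps A => f n)). Qed.

Lemma coef_fpsMn f k n : (f *+ k) n = f n *+ k.
Proof. by elim: k => [|k IH] //; rewrite !mulrS /= -IH. Qed.

Lemma coef_constM c f n : (fps_const c * f) n = c * f n.
Proof.
rewrite coef_fpsM big_ord_recl subn0 big1 ?addr0 // => i _.
by rewrite mul0r.
Qed.

Lemma fps_constB : {morph @fps_const A : c d / c - d}.
Proof. by move=> c d; apply: fpsP => -[|n] //=; rewrite subr0. Qed.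

Lemma fps_constM : {morph @fps_const A : c d / c * d}.
Proof.
by move=> c d; apply: fpsP => -[|n]; rewrite coef_constM //= mulr0.
Qed.

HB.instance Definition _ :=
  GRing.isZmodMorphism.Build A (fps A) (@fps_const A) fps_constB.
HB.instance Definition _ :=
  GRing.isMonoidMorphism.Build A (fps A) (@fps_const A) (erefl, fps_constM).

Definition fps_X : fps A := Fps (fun n => (n == 1)%:R).
(** Division by t^k with the remainder discarded; on bivariate series it acts on the variable x. *)
Definition fps_drop k f : fps A := Fps (fun n => f (k + n)%N).

Lemma coef_fpsXM f n : (fps_X * f) n = if n is m.+1 then f m else 0.
Proof.
rewrite coef_fpsM; case: n => [|n]; first by rewrite big_ord1 mul0r.
rewrite big_ord_recl mul0r add0r big_ord_recl /= mul1r subn1 big1 ?addr0 // => i _.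
by rewrite mul0r.
Qed.

Lemma coef_fpsXnM k f n :
  (fps_X ^+ k * f) n = if (n < k)%N then 0 else f (n - k)%N.
Proof.
elim: k n => [|k IH] n; first by rewrite mul1r subn0.
by rewrite exprS -mulrA coef_fpsXM; case: n => [//|n]; rewrite IH subSS.
Qed.

Lemma fps_X_inj f g : fps_X * f = fps_X * g -> f = g.
Proof.
move=> fg; apply: fpsP => n.
by have := congr1 (fun u : fps A => u n.+1) fg; rewrite !coef_fpsXM.
Qed.

Lemma fps_split k f :
  f = Fps (fun n => if (n < k)%N then f n else 0) + fps_X ^+ k * fps_drop k f.
Proof.
apply: fpsP => n; rewrite coef_fpsD coef_fpsXnM /=; case: ltnP => kn; rewrite ?addr0 //.
by rewrite add0r subnKC.
Qed.

Lemma coef_mul_low f g a b :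
  (forall i, (i < a)%N -> f i = 0) -> (forall i, (i < b)%N -> g i = 0) ->
  (f * g) (a + b)%N = f a * g b.
Proof.
move=> fa gb; rewrite coef_fpsM.
have ab : (a < (a + b).+1)%N by rewrite ltnS leq_addr.
rewrite (bigD1 (Ordinal ab)) //= addKn big1 ?addr0 // => i /eqP ia.
have [lia|gia|eia] := ltngtP i a; first by rewrite fa ?mul0r.
- rewrite [g _]gb ?mulr0 //; have := ltn_ord i; lia.
- by case: ia; apply: val_inj.
Qed.

Lemma coef_mul_low0 f g a b n :
  (forall i, (i < a)%N -> f i = 0) -> (forall i, (i < b)%N -> g i = 0) ->
  (n < a + b)%N -> (f * g) n = 0.
Proof.
move=> fa gb nab; rewrite coef_fpsM big1 // => i _.
have [ia|ai] := ltnP i a; first by rewrite fa ?mul0r.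
by rewrite [g _]gb ?mulr0 //; have := ltn_ord i; lia.
Qed.

(** Applied to the order in x, then to the order in y of the lowest coefficient, this gives the
    lexicographically first coefficient of a power. *)
Lemma coef_exp_low f a n : (forall i, (i < a)%N -> f i = 0) ->
  (f ^+ n) (n * a)%N = f a ^+ n /\ forall i, (i < n * a)%N -> (f ^+ n) i = 0.
Proof.
move=> fa; elim: n => [|n [IH1 IH2]]; first by split.
rewrite !exprS mulSn coef_mul_low // IH1; split=> // i ia.
exact: (coef_mul_low0 fa IH2).
Qed.

Lemma fps_derivB f g : fps_deriv (f - g) = fps_deriv f - fps_deriv g.
Proof. by apply: fpsP => n /=; rewrite mulrnBl. Qed.

HB.instance Definition _ :=
  GRing.isZmodMorphism.Build (fps A) (fps A) (@fps_deriv A) fps_derivB.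

Lemma fps_X_deriv f n : (fps_X * fps_deriv f) n = f n *+ n.
Proof. by rewrite coef_fpsXM; case: n => [|n] /=; rewrite ?mulr0n. Qed.

(** After multiplication by t the derivative is the diagonal operator n f_n, and Leibniz's rule is n
    = i + (n - i) inside the convolution. *)
Lemma fps_derivM f g :
  fps_deriv (f * g) = fps_deriv f * g + f * fps_deriv g.
Proof.
apply: fps_X_inj; rewrite mulrDr mulrA (mulrCA _ f); apply: fpsP => n.
rewrite fps_X_deriv coef_fpsD !coef_fpsM -big_split -sumrMnl.
apply: eq_bigr => i _; rewrite !fps_X_deriv mulrnAl mulrnAr -[RHS]mulrnDr subnKC //.
by rewrite -ltnS.
Qed.

End FpsBasics.

(** * Bivariate series: partial derivatives, monomials, Koszul division *)

Section Bivariate.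
Variable K : comNzRingType.
Implicit Types (f g h : fps2 K) (u : nat -> fps2 K) (l m : fps K).

Definition ser_X : fps2 K := fps_X (fps K).
Definition ser_Y : fps2 K := fps_const (fps_X K).

Lemma coef_fps2M f g i j : (f * g) i j =
  \sum_(a < i.+1) \sum_(b < j.+1) f a b * g (i - a)%N (j - b)%N.
Proof. by rewrite coef_fpsM coef_fps_sum. Qed.

Lemma coef_ser_constM (c : K) f i j : (ser_const c * f) i j = c * f i j.
Proof. by rewrite !coef_constM. Qed.

Lemma ser_const0 : ser_const (0 : K) = 0.
Proof. by rewrite /ser_const !rmorph0. Qed.
Lemma ser_constD (c d : K) : ser_const (c + d) = ser_const c + ser_const d.
Proof. by rewrite /ser_const !rmorphD. Qed.
Lemma ser_constM (c d : K) : ser_const (c * d) = ser_const c * ser_const d.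
Proof. by rewrite /ser_const !rmorphM. Qed.
Lemma ser_const_nat n : ser_const (n%:R : K) = n%:R.
Proof. by rewrite /ser_const !rmorph_nat. Qed.
Lemma ser_const_sum (I : Type) (r : seq I) (P : pred I) (F : I -> K) :
  ser_const (\sum_(i <- r | P i) F i) = \sum_(i <- r | P i) ser_const (F i).
Proof. exact: (big_morph _ ser_constD ser_const0). Qed.

Lemma ser_xD f g : ser_x (f + g) = ser_x f + ser_x g.
Proof. exact: raddfD. Qed.
Lemma ser_xN f : ser_x (- f) = - ser_x f.
Proof. exact: raddfN. Qed.
Lemma ser_xM f g : ser_x (f * g) = ser_x f * g + f * ser_x g.
Proof. exact: fps_derivM. Qed.
Lemma ser_yD f g : ser_y (f + g) = ser_y f + ser_y g.
Proof. by apply: fpsP => i; exact: raddfD. Qed.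
Lemma ser_yN f : ser_y (- f) = - ser_y f.
Proof. by apply: fpsP => i; exact: raddfN. Qed.
Lemma ser_yM f g : ser_y (f * g) = ser_y f * g + f * ser_y g.
Proof.
apply: fpsP => i /=; rewrite raddf_sum /= -big_split /=.
by apply: eq_bigr => a _; rewrite fps_derivM.
Qed.
Lemma ser_xyC f : ser_x (ser_y f) = ser_y (ser_x f).
Proof. by apply: fpsP => i; apply: fpsP => j /=; rewrite !coef_fpsMn /= mulrnAC. Qed.
Lemma ser_x_const (c : K) : ser_x (ser_const c) = 0.
Proof. by apply: fpsP => i /=; rewrite mul0rn. Qed.
Lemma ser_y_const (c : K) : ser_y (ser_const c) = 0.
Proof. by apply: fpsP => -[|i]; apply: fpsP => j /=; rewrite mul0rn. Qed.
Lemma ser_x_X : ser_x ser_X = 1 :> fps2 K.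
Proof. by apply: fpsP => -[|i] //=; rewrite mul0rn. Qed.
Lemma ser_y_X : ser_y ser_X = 0.
Proof. by apply: fpsP => -[|[|i]]; apply: fpsP => -[|j] /=; rewrite ?mul0rn. Qed.
Lemma ser_x_Y : ser_x ser_Y = 0.
Proof. by apply: fpsP => -[|i] //=; rewrite mul0rn. Qed.
Lemma ser_y_Y : ser_y ser_Y = 1.
Proof. by apply: fpsP => -[|i]; apply: fpsP => -[|j] //=; rewrite mul0rn. Qed.

Lemma ser_X_x f i j : (ser_X * ser_x f) i j = f i j *+ i.
Proof. by rewrite fps_X_deriv coef_fpsMn. Qed.
Lemma ser_Y_y f i j : (ser_Y * ser_y f) i j = f i j *+ j.
Proof. by rewrite coef_constM fps_X_deriv. Qed.

Lemma coef_ser_XnM k f i j :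
  (ser_X ^+ k * f) i j = if (i < k)%N then 0 else f (i - k)%N j.
Proof. by rewrite coef_fpsXnM; case: ifP. Qed.
Lemma coef_ser_YnM k f i j :
  (ser_Y ^+ k * f) i j = if (j < k)%N then 0 else f i (j - k)%N.
Proof. by rewrite -rmorphXn coef_constM coef_fpsXnM. Qed.

Lemma coef_monomial i j p q : (ser_X ^+ i * ser_Y ^+ j : fps2 K) p q =
  ((p == i) && (q == j))%:R.
Proof.
rewrite -[ser_Y ^+ j]mulr1 coef_ser_XnM coef_ser_YnM.
case: ltnP => ip; first by rewrite ltn_eqF.
have [->|pi] := eqVneq p i; last first.
  case E: (p - i)%N => [|m]; first by move: pi; lia.
  by case: ifP.
rewrite subnn; case: ltnP => jq; first by rewrite ltn_eqF.
have [->|qj] := eqVneq q j; first by rewrite subnn.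
by case E: (q - j)%N => [|m] //; move: qj; lia.
Qed.

Lemma ser_Xn_inj k f g : ser_X ^+ k * f = ser_X ^+ k * g -> f = g.
Proof.
move=> fg; apply: fpsP => i; have := congr1 (fun u : fps2 K => u (i + k)%N) fg.
by rewrite !coef_fpsXnM ltnNge leq_addl addnK.
Qed.
Lemma ser_Yn_inj k f g : ser_Y ^+ k * f = ser_Y ^+ k * g -> f = g.
Proof.
move=> fg; apply: fpsP => i; apply: fpsP => j.
have := congr1 (fun u : fps2 K => u i (j + k)%N) fg.
by rewrite !coef_ser_YnM ltnNge leq_addl addnK.
Qed.

(* Exactness of the Koszul complex of (u, v), an ideal that contains x^k and y^k. *)
Lemma koszul_division k (a a' b b' u v f g : fps2 K) :
  ser_X ^+ k = a * u + b * v -> ser_Y ^+ k = a' * u + b' * v ->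
  f * u = g * v ->
  let w := fps_drop k (a * g + b * f) in f = w * v /\ g = w * u.
Proof.
(* Multiplying x^k = a u + b v by f and replacing f u by g v factors out v, with quotient [s]; [t]
   plays the same role for y^k. *)
move=> eX eY e w; set s := a * g + b * f; pose t := a' * g + b' * f.
have Xf : ser_X ^+ k * f = s * v.
  by rewrite eX /s mulrDl -mulrA (mulrC u) e; ring.
have Xg : ser_X ^+ k * g = s * u.
  by rewrite eX /s mulrDl -(mulrA b) (mulrC v) -e; ring.
have Yf : ser_Y ^+ k * f = t * v.
  by rewrite eY /t mulrDl -mulrA (mulrC u) e; ring.
have Yg : ser_Y ^+ k * g = t * u.
  by rewrite eY /t mulrDl -(mulrA b') (mulrC v) -e; ring.
have st : ser_Y ^+ k * s = ser_X ^+ k * t.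
  (* Multiplication by y^k = a' u + b' v reduces the equality to its multiples by u and by v, where
     both sides are x^k y^k g and x^k y^k f. *)
  apply: (@ser_Yn_inj k); rewrite {1 3}eY !mulrDl.
  have -> : a' * u * (ser_Y ^+ k * s) = a' * (ser_Y ^+ k * (s * u)) by ring.
  have -> : b' * v * (ser_Y ^+ k * s) = b' * (ser_Y ^+ k * (s * v)) by ring.
  have -> : a' * u * (ser_X ^+ k * t) = a' * (ser_X ^+ k * (t * u)) by ring.
  have -> : b' * v * (ser_X ^+ k * t) = b' * (ser_X ^+ k * (t * v)) by ring.
  by rewrite -Xf -Xg -Yf -Yg; ring.
(* As y^k s is divisible by x^k and y^k does not affect degrees in x, s itself is divisible by
   x^k. *)
have sw : s = ser_X ^+ k * w.
  rewrite {1}(fps_split k s) -[RHS]add0r; congr (_ + _).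
  apply: fpsP => i /=; case: ifP => // ik.
  apply: fpsP => j; have := congr1 (fun u : fps2 K => u i (j + k)%N) st.
  by rewrite (coef_ser_XnM k t) (coef_ser_YnM k s) ik ltnNge leq_addl addnK.
by split; apply: (@ser_Xn_inj k); rewrite ?Xf ?Xg sw mulrA.
Qed.

End Bivariate.
Arguments ser_X {K}.
Arguments ser_Y {K}.

(** * Series in h *)

Section Hsum.
Variable K : comNzRingType.
Implicit Types (f g h : fps2 K) (u : nat -> fps2 K) (l m : fps K).

Definition vanishes_to n f := forall i j, (i + j < n)%N -> f i j = 0.

Lemma vanishes_toM (m n : nat) f g :
  vanishes_to m f -> vanishes_to n g -> vanishes_to (m + n) (f * g).
Proof.
move=> fm gn i j ij; rewrite coef_fps2M big1 // => a _; rewrite big1 // => b _.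
have [ab|ab] := ltnP (a + b)%N m; first by rewrite fm ?mul0r.
by rewrite [g _ _]gn ?mulr0 //; have := ltn_ord a; have := ltn_ord b; lia.
Qed.

Lemma vanishes_toX (h : fps2 K) n : h 0%N 0%N = 0 -> vanishes_to n (h ^+ n).
Proof.
move=> h0; elim: n => [|n IH] //; rewrite exprS -add1n.
by apply: vanishes_toM => // -[|i] [|j].
Qed.

Lemma vanishes_toXM (h : fps2 K) n f : h 0%N 0%N = 0 -> vanishes_to n (h ^+ n * f).
Proof.
move=> h0; rewrite -[n]addn0; apply: vanishes_toM => //; rewrite addn0.
exact: vanishes_toX.
Qed.

Lemma eq0_of_divisible (h f : fps2 K) : h 0%N 0%N = 0 ->
  (forall n, exists g, f = h ^+ n * g) -> f = 0.
Proof.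
move=> h0 fh; apply: fpsP => i; apply: fpsP => j.
by have [g ->] := fh (i + j).+1; rewrite (vanishes_toXM (n := (i + j).+1)).
Qed.

(** The pattern behind the identities between series in h: if the defect [E t] is h times the defect
    at a shifted parameter, it lies in every power of h and hence vanishes. *)
Lemma hadic_ind (T : Type) (E : T -> fps2 K) (s : T -> T) (h : fps2 K) :
  h 0%N 0%N = 0 -> (forall t, E t = h * E (s t)) -> forall t, E t = 0.
Proof.
move=> h0 Es t; apply: (eq0_of_divisible h0) => n; exists (E (iter n s t)).
by elim: n => [|n IH]; rewrite ?mul1r // IH exprSr -mulrA -Es.
Qed.

(* \sum_n h^n u_n; the truncation at n <= i + j is harmless only when h(0) = 0. *)
Definition hsum (h : fps2 K) (u : nat -> fps2 K) : fps2 K :=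
  Fps (fun i => Fps (fun j => \sum_(n < (i + j).+1) (h ^+ n * u n) i j)).

Lemma coef_hsum h u N i j : h 0%N 0%N = 0 -> (i + j < N)%N ->
  hsum h u i j = \sum_(n < N) (h ^+ n * u n) i j.
Proof.
move=> h0 ijN /=; rewrite (big_ord_widen N (fun n => (h ^+ n * u n) i j)) //.
rewrite big_mkcond /=; apply: eq_bigr => n _; case: ltnP => // ijn.
by rewrite (vanishes_toXM (n := n)).
Qed.

Lemma hsum_rec h u : h 0%N 0%N = 0 ->
  hsum h u = u 0%N + h * hsum h (fun n => u n.+1).
Proof.
move=> h0; apply: fpsP => i; apply: fpsP => j.
rewrite (@coef_hsum _ _ (i + j).+1) // big_ord_recl expr0 mul1r.
congr (_ + _); set N := (i + j)%N.
under eq_bigr do rewrite lift0 exprS -mulrA.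
pose v := \sum_(n < N) h ^+ n * u n.+1.
transitivity ((h * v) i j); first by rewrite mulr_sumr !coef_fps_sum.
rewrite !coef_fps2M; apply: eq_bigr => a _; apply: eq_bigr => b _.
(* As h has no constant term, only coefficients of the tail of total degree below [N] enter, and its
   first [N] terms determine them. *)
have [/andP[/eqP a0 /eqP b0]|ab] := boolP ((a == 0 :> nat) && (b == 0 :> nat)).
  by rewrite a0 b0 h0 !mul0r.
congr (_ * _); rewrite (@coef_hsum _ _ N) ?{1}/v ?coef_fps_sum //.
by have := ltn_ord a; have := ltn_ord b; rewrite /N; move: ab; lia.
Qed.

Lemma coef_ser_comp l h i j :
  ser_comp l h i j = \sum_(n < (i + j).+1) l n * (h ^+ n) i j.
Proof. by []. Qed.

Lemma ser_comp_hsum l (h : fps2 K) :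
  ser_comp l h = hsum h (fun n => ser_const (l n)).
Proof.
apply: fpsP => i; apply: fpsP => j; rewrite coef_ser_comp.
by apply: eq_bigr => n _; rewrite [h ^+ n * _]mulrC coef_ser_constM.
Qed.

Lemma ser_comp_rec l (h : fps2 K) : h 0%N 0%N = 0 ->
  ser_comp l h = ser_const (l 0%N) + h * ser_comp (fps_drop 1 l) h.
Proof. by move=> h0; rewrite !ser_comp_hsum hsum_rec. Qed.

Lemma ser_compB l m (h : fps2 K) : ser_comp (l - m) h = ser_comp l h - ser_comp m h.
Proof.
apply: fpsP => i; apply: fpsP => j; rewrite [RHS]/= -sumrB.
by apply: eq_bigr => n _; rewrite mulrBl.
Qed.

Lemma ser_comp0 (h : fps2 K) : ser_comp 0 h = 0.
Proof. by rewrite -[0 in LHS](subrr 0) ser_compB subrr. Qed.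

Lemma ser_comp_const (c : K) (h : fps2 K) : h 0%N 0%N = 0 ->
  ser_comp (fps_const c) h = ser_const c.
Proof.
move=> h0; rewrite ser_comp_rec //.
have -> : fps_drop 1 (fps_const c) = 0 by apply: fpsP.
by rewrite ser_comp0 mulr0 addr0.
Qed.

(** Writing l = l(0) + t l_1, the defect of multiplicativity at l is h times the one at l_1, because
    substitution respects multiplication by constants and by t. *)
Lemma ser_compM l m (h : fps2 K) : h 0%N 0%N = 0 ->
  ser_comp (l * m) h = ser_comp l h * ser_comp m h.
Proof.
move=> h0; apply/eqP; rewrite -subr_eq0; apply/eqP.
pose E l := ser_comp (l * m) h - ser_comp l h * ser_comp m h.
apply: (hadic_ind (E := E) (s := fps_drop 1) h0) => {}l.
have e : l * m = fps_const (l 0%N) * m - fps_X _ * (- fps_drop 1 l * m).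
  rewrite {1}(fps_split 1 l) expr1.
  have -> : Fps (fun n => if (n < 1)%N then l n else 0) = fps_const (l 0%N).
    by apply: fpsP => -[].
  ring.
have compC c n : ser_comp (fps_const c * n) h = ser_const c * ser_comp n h.
  apply: fpsP => i; apply: fpsP => j; rewrite coef_ser_constM !coef_ser_comp mulr_sumr.
  by apply: eq_bigr => k _; rewrite coef_constM mulrA.
have compX n : ser_comp (fps_X _ * n) h = h * ser_comp n h.
  rewrite ser_comp_rec // coef_fpsXM.
  have -> : fps_drop 1 (fps_X _ * n) = n.
    by apply: fpsP => i; rewrite -[LHS]/((fps_X K * n) i.+1) coef_fpsXM.
  by rewrite ser_const0 add0r.
have compN n : ser_comp (- n) h = - ser_comp n h.
  by rewrite -sub0r ser_compB ser_comp0 sub0r.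
rewrite /E {1}e ser_compB compC compX mulNr compN (ser_comp_rec l) //; ring.
Qed.

(** The exchange of x and y transports to y what is set up for x, such as [fps_drop]. *)
Definition ser_swap f : fps2 K := Fps (fun i => Fps (fun j => f j i)).

Lemma ser_swapM f g : ser_swap (f * g) = ser_swap f * ser_swap g.
Proof.
apply: fpsP => i; apply: fpsP => j; rewrite [LHS]/= !coef_fps2M.
exact: exchange_big.
Qed.

Lemma ser_swapK : involutive (@ser_swap).
Proof. by move=> f; do 2!apply: fpsP => ?. Qed.

Lemma ser_swapD f g : ser_swap (f + g) = ser_swap f + ser_swap g.
Proof. by []. Qed.

Lemma ser_swapYn k : ser_swap (ser_Y ^+ k) = ser_X ^+ k :> fps2 K.
Proof.
apply: fpsP => i; apply: fpsP => j; rewrite [LHS]/=.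
rewrite -[ser_Y ^+ k]mulr1 -[ser_X ^+ k]mulr1 coef_ser_XnM coef_ser_YnM.
by case: ifP => // _; case: (i - k)%N => [|?]; case: j.
Qed.

End Hsum.

(** * The Hamiltonian derivation *)

Section QuasiHomogeneous.
Variables (K : numFieldType) (p1 p2 d : nat) (H : fps2 K).
Hypotheses (p1_gt0 : (0 < p1)%N) (p2_gt0 : (0 < p2)%N) (d_gt0 : (0 < d)%N).
Hypothesis weight_H :
  forall i j, (p1 * i + p2 * j)%:R * H i j = d%:R * H i j.
Implicit Types f g k : fps2 K.

Definition ham f : fps2 K := ser_y H * ser_x f - ser_x H * ser_y f.

(* The operators R + c and (R + c)^-1, which are diagonal on monomials. *)
Definition wt (c : nat) f : fps2 K :=
  Fps (fun i => Fps (fun j => (p1 * i + p2 * j + c)%:R * f i j)).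
Definition winv (c : nat) f : fps2 K :=
  Fps (fun i => Fps (fun j => (p1 * i + p2 * j + c)%:R^-1 * f i j)).

Lemma wtK c : (0 < c)%N -> cancel (wt c) (winv c).
Proof.
move=> c0 f; apply: fpsP => i; apply: fpsP => j /=.
by rewrite mulKf // pnatr_eq0 -lt0n addn_gt0 c0 orbT.
Qed.

Lemma winvK c : (0 < c)%N -> cancel (winv c) (wt c).
Proof.
move=> c0 f; apply: fpsP => i; apply: fpsP => j /=.
by rewrite mulVKf // pnatr_eq0 -lt0n addn_gt0 c0 orbT.
Qed.

Lemma coef_natM n f i j : (n%:R * f) i j = n%:R * f i j.
Proof. by rewrite mulr_natl !coef_fpsMn mulr_natl. Qed.

Lemma wtE c f :
  wt c f = p1%:R * (ser_X * ser_x f) + p2%:R * (ser_Y * ser_y f) + c%:R * f.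
Proof.
apply: fpsP => i; apply: fpsP => j; rewrite !coef_fpsD !coef_natM.
rewrite ser_X_x ser_Y_y /= !natrD !natrM; ring.
Qed.

Lemma ser_x_nat n f : ser_x (n%:R * f) = n%:R * ser_x f.
Proof. by rewrite !mulr_natl /ser_x raddfMn. Qed.
Lemma ser_y_nat n f : ser_y (n%:R * f) = n%:R * ser_y f.
Proof.
by rewrite !mulr_natl; elim: n => [|n IH]; rewrite ?mulrS ?ser_yD ?IH //;
  apply: fpsP => i; apply: fpsP => j /=; rewrite mul0rn.
Qed.

Definition ser_d := (ser_xD, ser_yD, ser_xN, ser_yN, ser_x_nat, ser_y_nat,
  ser_xM, ser_yM, ser_x_X, ser_y_X, ser_x_Y, ser_y_Y).

Lemma euler : p1%:R * (ser_X * ser_x H) + p2%:R * (ser_Y * ser_y H) = d%:R * H.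
Proof.
rewrite -[LHS]addr0 -[X in _ + X](mul0r H) -(wtE 0).
by apply: fpsP => i; apply: fpsP => j; rewrite coef_natM /= addn0 weight_H.
Qed.

Lemma euler_x : p1%:R * (ser_x H + ser_X * ser_x (ser_x H)) +
  p2%:R * (ser_Y * ser_y (ser_x H)) = d%:R * ser_x H.
Proof. by have := congr1 (@ser_x K) euler; rewrite !ser_d mul1r mul0r add0r ser_xyC. Qed.

Lemma euler_y : p1%:R * (ser_X * ser_y (ser_x H)) +
  p2%:R * (ser_y H + ser_Y * ser_y (ser_y H)) = d%:R * ser_y H.
Proof. by have := congr1 (@ser_y K) euler; rewrite !ser_d mul1r mul0r add0r. Qed.

Lemma weight_H00 : H 0%N 0%N = 0.
Proof.
by have /esym/eqP := weight_H 0 0; rewrite !muln0 mul0r mulf_eq0 pnatr_eq0 eqn0Ngt d_gt0 => /eqP.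
Qed.

(** The vector field [ham] is homogeneous of weight d - p1 - p2: the two sides differ by the Euler
    relation of h_y times f_x minus that of h_x times f_y. *)
Lemma ham_wt f : wt (p1 + p2) (ham f) = ham (wt d f).
Proof.
rewrite !wtE /ham !ser_d !ser_xyC !natrD.
have := euler_x; have := euler_y.
move: (ser_x H) (ser_y H) (ser_x f) (ser_y f) => hx hy fx fy ey ex.
apply/eqP; rewrite -subr_eq0; apply/eqP.
set P1 : fps2 K := p1%:R in ex ey *; set P2 : fps2 K := p2%:R in ex ey *.
set D : fps2 K := d%:R in ex ey *.
transitivity ((P1 * (ser_X * ser_y hx) + P2 * (hy + ser_Y * ser_y hy) - D * hy) * fx
   - (P1 * (hx + ser_X * ser_x hx) + P2 * (ser_Y * ser_y hx) - D * hx) * fy).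
  by rewrite !(mulr1, mul0r, mul1r, add0r); ring.
by rewrite ex ey !subrr !mul0r subrr.
Qed.

Lemma hamD f g : ham (f + g) = ham f + ham g.
Proof. rewrite /ham !ser_d; ring. Qed.
Lemma hamM f g : ham (f * g) = ham f * g + f * ham g.
Proof. rewrite /ham !ser_d; ring. Qed.
Lemma ham_const c : ham (ser_const c) = 0.
Proof. by rewrite /ham ser_x_const ser_y_const !mulr0 subrr. Qed.
Lemma ham_H : ham H = 0.
Proof. by rewrite /ham mulrC subrr. Qed.
Lemma ham_nat n f : ham (n%:R * f) = n%:R * ham f.
Proof. rewrite /ham !ser_d; ring. Qed.

Lemma ham_comp l : ham (ser_comp l H) = 0.
Proof.
apply: (hadic_ind (E := fun l => ham (ser_comp l H)) (s := fps_drop 1) weight_H00).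
move=> {}l; rewrite (ser_comp_rec _ weight_H00) hamD ham_const add0r hamM ham_H.
by rewrite mul0r add0r.
Qed.

(* Cartan's formula L_R = d i_R + i_R d for the form winv p2 b dy - winv p1 c dx. *)
Lemma jacobian_split b c :
  b * ser_x H + c * ser_y H =
  ham (p1%:R * (ser_X * winv p1 c) - p2%:R * (ser_Y * winv p2 b)) +
  H * (d%:R * (ser_x (winv p2 b) + ser_y (winv p1 c))).
Proof.
have dH z : H * (d%:R * z) = d%:R * H * z by ring.
rewrite -{1}(winvK p2_gt0 b) -{1}(winvK p1_gt0 c) dH -euler.
move: (winv p2 b) (winv p1 c) => {}b {}c.
rewrite !wtE /ham !ser_d !(mulr1, mul0r, mul1r, add0r).
move: (ser_x H) (ser_y H) => hx hy; ring.
Qed.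

Lemma wt0_const f : wt 0 f = 0 -> f = ser_const (f 0%N 0%N).
Proof.
move=> wf; apply: fpsP => i; apply: fpsP => j.
have := congr1 (fun u : fps2 K => u i j) wf; rewrite [LHS]/= addn0.
have [/andP[/eqP-> /eqP->] _ //|ij] := boolP ((i == 0) && (j == 0))%N.
move/eqP; rewrite mulf_eq0 pnatr_eq0 => /orP[|/eqP->].
  by rewrite addn_eq0 !muln_eq0 !eqn0Ngt p1_gt0 p2_gt0 /= -!eqn0Ngt (negPf ij).
by case: i j ij => [|i] [|j].
Qed.

Section Koszul.
Variables (N : nat) (a1 b1 a2 b2 : fps2 K).
Hypothesis XnE : ser_X ^+ N = a1 * ser_x H + b1 * ser_y H.
Hypothesis YnE : ser_Y ^+ N = a2 * ser_x H + b2 * ser_y H.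

(** Replacing d h by Euler's formula in d h f = d {h, g} gives a Koszul relation, whose solution k
    satisfies d dg + f (p1 x dy - p2 y dx) = k dh. Its exterior derivative is (R + p1 + p2) f = {h,
    k}. The preimage is kept explicit so that its convergence can be checked. *)
Lemma ham_torsion f g : H * f = ham g ->
  f = ham (winv d (fps_drop N
    (a1 * (d%:R * ser_x g - p2%:R * (ser_Y * f)) +
     b1 * (p1%:R * (ser_X * f) + d%:R * ser_y g)))).
Proof.
move=> Hfg.
have e : (p1%:R * (ser_X * f) + d%:R * ser_y g) * ser_x H =
         (d%:R * ser_x g - p2%:R * (ser_Y * f)) * ser_y H.
  have : d%:R * H * f = d%:R * ham g by rewrite -mulrA Hfg.
  rewrite -euler /ham => e; apply/eqP; rewrite -subr_eq0; apply/eqP.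
  transitivity ((p1%:R * (ser_X * ser_x H) + p2%:R * (ser_Y * ser_y H)) * f -
    d%:R * (ser_y H * ser_x g - ser_x H * ser_y g)); first by ring.
  by rewrite e subrr.
have [] := koszul_division XnE YnE e.
set k := fps_drop _ _ => ey ex.
have p12 : (0 < p1 + p2)%N by rewrite addn_gt0 p1_gt0.
apply: (can_inj (wtK p12)); rewrite ham_wt winvK //.
(* The x-derivative of one relation minus the y-derivative of the other: the terms d g_xy and k h_xy
   cancel. *)
have := congr1 (@ser_x K) ey; have := congr1 (@ser_y K) ex.
rewrite !ser_d ser_xyC !mul1r => ey' ex'.
rewrite wtE /ham !natrD; apply/eqP; rewrite -subr_eq0; apply/eqP.
move/eqP: ey'; rewrite -subr_eq0 => /eqP ey'.
move/eqP: ex'; rewrite -subr_eq0 => /eqP ex'.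
rewrite -[RHS](subrr 0) -{1}ex' -{1}ey' ser_xyC.
move: (ser_y (ser_x g)) (ser_y (ser_x H)) => gxy hxy; ring.
Qed.

(** From df = k dh follows R f = d h k, while R(h g) = h (R + d) g. With (R + d) g = d k the
    difference f - h g is killed by R, hence constant. Equality of the mixed derivatives of f gives
    {h, k} = 0, and [ham_wt] passes this on to g. *)
Lemma ham_kernel_step f : ham f = 0 ->
  exists2 g, ham g = 0 & f = ser_const (f 0%N 0%N) + H * g.
Proof.
move=> f0.
have e : ser_y f * ser_x H = ser_x f * ser_y H.
  by apply/esym/eqP; rewrite -subr_eq0 mulrC [X in _ - X]mulrC; apply/eqP.
have [] := koszul_division XnE YnE e; set k := fps_drop _ _ => fy fx.
have k0 : ham k = 0.
  have ey := congr1 (@ser_x K) fy; have := congr1 (@ser_y K) fx.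
  rewrite !ser_d !ser_xyC in ey *; rewrite ey => /addIr ek.
  by rewrite /ham mulrC ek mulrC subrr.
pose g := winv d (d%:R * k).
have wg : wt d g = d%:R * k by exact: winvK.
exists g.
  have p12 : (0 < p1 + p2)%N by rewrite addn_gt0 p1_gt0.
  apply: (can_inj (wtK p12)); rewrite ham_wt wg ham_nat k0 mulr0.
  by apply: fpsP => i; apply: fpsP => j /=; rewrite mulr0.
have wf : wt 0 (f - H * g) = 0.
  have : wt 0 f = H * wt d g.
    rewrite wg mulrCA -[H * k]mulrC mulrCA -euler wtE fx fy; ring.
  move=> e0; rewrite -[RHS](subrr (H * wt d g)) -{1}e0 !wtE.
  rewrite !ser_d; apply/eqP; rewrite -subr_eq0; apply/eqP.
  transitivity ((d%:R * H - (p1%:R * (ser_X * ser_x H) + p2%:R * (ser_Y * ser_y H))) * g).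
    ring.
  by rewrite euler subrr mul0r.
apply/eqP; rewrite -subr_eq; apply/eqP; rewrite [LHS](wt0_const wf).
congr ser_const.
rewrite -[LHS]/(f 0%N 0%N - (H * g) 0%N 0%N).
by rewrite coef_fps2M !big_ord1 weight_H00 mul0r subr0.
Qed.

End Koszul.

End QuasiHomogeneous.

(** * Powers of x and y in the Jacobian ideal *)

(** The polynomials among the series, which are bounded on polydiscs of every radius. *)
Definition supported_in (K : comNzRingType) (N : nat) (f : fps2 K) :=
  forall i j, (N <= i)%N || (N <= j)%N -> f i j = 0.

Section Evaluation.
Variable K : comNzRingType.
Implicit Types (f : fps2 K) (a b s : K).

Definition ser_eval N f a b := \sum_(i < N) \sum_(j < N) f i j * a ^+ i * b ^+ j.

(** Here f has weight d - e, as a partial derivative of h does; the factor s^e on the left avoids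
    the subtraction. *)
Lemma ser_eval_scale N f (q1 q2 e d : nat) s a b :
  (forall i j, f i j != 0 -> (q1 * i + q2 * j + e)%N = d) ->
  s ^+ e * ser_eval N f (a * s ^+ q1) (b * s ^+ q2) = s ^+ d * ser_eval N f a b.
Proof.
move=> fw; rewrite !mulr_sumr; apply: eq_bigr => i _.
rewrite !mulr_sumr; apply: eq_bigr => j _.
have [->|/fw <-] := eqVneq (f i j) 0; first by rewrite !(mul0r, mulr0).
by rewrite !exprD !exprM !exprMn -!exprM; ring.
Qed.

Lemma ser_eval_swap N f a b : ser_eval N (ser_swap f) a b = ser_eval N f b a.
Proof.
rewrite /ser_eval exchange_big; apply: eq_bigr => i _; apply: eq_bigr => j _ /=.
by rewrite mulrAC.
Qed.

Lemma ser_eval_of_pol (g : {poly {poly K}}) N a b :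
  supported_in N (ser_of_pol g) -> ser_eval N (ser_of_pol g) a b = g.[a, b].
Proof.
move=> gN; have sg : (size g <= N)%N.
  apply/leq_sizeP => i Ni; apply/polyP => j; rewrite coef0.
  by rewrite -[LHS]/(ser_of_pol g i j) gN ?Ni.
have sgi i : (size (g`_i)%R <= N)%N.
  by apply/leq_sizeP => j Nj; rewrite -[LHS]/(ser_of_pol g i j) gN ?Nj ?orbT.
rewrite (horner_coef_wide _ sg) horner_sum; apply: eq_bigr => i _.
rewrite hornerM -rmorphXn hornerC (horner_coef_wide _ (sgi i)) mulr_suml.
by apply: eq_bigr => j _; rewrite mulrAC.
Qed.

Lemma supported_of_pol (g : {poly {poly K}}) : exists N, supported_in N (ser_of_pol g).
Proof.
exists (maxn (size g) (\max_(i < size g) size (g`_i)%R)) => i j /= ij.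
have [gi|ig] := leqP (size g) i; first by rewrite (nth_default _ gi) coef0.
rewrite nth_default //; case/orP: ij => [|].
  by rewrite geq_max leqNgt ig.
rewrite geq_max => /andP[_]; apply: leq_trans.
exact: (leq_bigmax (Ordinal ig)).
Qed.

Lemma supported_in_le M N f : (M <= N)%N -> supported_in M f -> supported_in N f.
Proof. by move=> MN fM i j ij; apply: fM; move: ij; lia. Qed.

End Evaluation.

Section Bezout.
Variables (K : numClosedFieldType) (q1 q2 d : nat).
Hypothesis q2_gt0 : (0 < q2)%N.

(** Keeps the monomials of weight q2 k - (d - s), so that the product with a series of weight d - s
    has the weight of y^k. An index i for which no j fits is dropped; it would meet no monomial of
    that series in a coefficient of weight q2 k. *)
Let homogenize s k (u : {poly K}) : fps2 K := Fps (fun i => Fps (fun j =>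
  if (q1 * i + q2 * j + d == q2 * k + s)%N then u`_i else 0)).

Let dehomogenize N (f : fps2 K) : {poly K} := \poly_(i < N) \sum_(j < N) f i j.

Lemma homogenizeM N s k (u : {poly K}) (f : fps2 K) n m :
  supported_in N f ->
  (forall i j, f i j != 0 -> (q1 * i + q2 * j + s)%N = d) ->
  (N + q1 * (size u + N) <= k)%N ->
  (homogenize s k u * f) n m =
  if (q1 * n + q2 * m == q2 * k)%N then (u * dehomogenize N f)`_n else 0.
Proof.
move=> fN fw k_ge; rewrite coef_fps2M.
(* Across from a nonzero coefficient of f, the weight condition on the cofactor is the weight
   condition on the product. *)
have wa (a : 'I_n.+1) (b : 'I_m.+1) : f (n - a)%N (m - b)%N != 0 ->
    (q1 * a + q2 * b + d == q2 * k + s)%N = (q1 * n + q2 * m == q2 * k)%N.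
  move=> /fw <-; have := ltn_ord a; have := ltn_ord b; rewrite !ltnS => bm an.
  have := congr1 (muln q1) (subnK an); have := congr1 (muln q2) (subnK bm).
  by rewrite !mulnDr; lia.
case: eqP => [w|w]; last first.
  rewrite big1 // => a _; rewrite big1 // => b _ /=.
  have [->|/wa ->] := eqVneq (f (n - a)%N (m - b)%N) 0; first by rewrite mulr0.
  by move/eqP/negPf: w => ->; rewrite mul0r.
rewrite coefM; apply: eq_bigr => a _; rewrite coef_poly.
transitivity (u`_a * \sum_(b < m.+1) f (n - a)%N (m - b)%N).
  rewrite mulr_sumr; apply: eq_bigr => b _ /=.
  have [->|/wa ->] := eqVneq (f (n - a)%N (m - b)%N) 0; first by rewrite !mulr0.
  by rewrite w eqxx.
have [ua|au] := leqP (size u) a; first by rewrite nth_default // !mul0r.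
congr (_ * _); case: ltnP => naN; last first.
  by rewrite big1 // => b _; rewrite fN ?naN.
(* Here n < size u + N, so the lower bound on k pushes m beyond the degree of f in y, and no term of
   f(x, 1) is cut off. *)
have Nm : (N <= m)%N.
  rewrite leqNgt; apply/negP => mN; have := ltn_ord a; nia.
rewrite (reindex_inj rev_ord_inj) /=.
under eq_bigr => b _ do rewrite subSS subKn -1?ltnS ?ltn_ord //.
rewrite [RHS](big_ord_widen m.+1 (fun j => f (n - a)%N j)) 1?leqW //.
rewrite [RHS]big_mkcond /=; apply: eq_bigr => j _; case: ltnP => // Nj.
by rewrite fN // Nj orbT.
Qed.

Lemma supported_homogenize s k u : exists N, supported_in N (homogenize s k u).
Proof.
exists (maxn (size u) (q2 * k + s).+1) => i j /= ij; case: eqP => // e.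
apply: nth_default; nia.
Qed.

(** The polynomials f(x, 1) and g(x, 1) are coprime, and the constant 1 homogenized to the weight of
    y^k is y^k. All large k are covered because x and y later need a common exponent. *)
Lemma homogeneous_bezout N s t (f g : fps2 K) :
  supported_in N f -> supported_in N g ->
  (forall i j, f i j != 0 -> (q1 * i + q2 * j + s)%N = d) ->
  (forall i j, g i j != 0 -> (q1 * i + q2 * j + t)%N = d) ->
  (forall a, ser_eval N f a 1 = 0 -> ser_eval N g a 1 = 0 -> False) ->
  exists k0, forall k, (k0 <= k)%N -> exists u v M,
    [/\ supported_in M u, supported_in M v & ser_Y ^+ k = u * f + v * g].
Proof.
move=> fN gN fw gw fg0; set p := dehomogenize N f; set q := dehomogenize N g.
have evE e a : (dehomogenize N e).[a] = ser_eval N e a 1.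
  rewrite horner_poly; apply: eq_bigr => i _; rewrite mulr_suml.
  by apply: eq_bigr => j _; rewrite expr1n mulr1.
have /Bezout_coprimepP[[u v] /= uv1] : coprimep p q.
  apply: Pdiv.ClosedField.root_coprimep => a /rootP pa; apply/eqP => qa.
  by apply: (fg0 a); rewrite -evE.
have [c c0 uvc] : exists2 c, c != 0 & u * p + v * q = c%:P.
  by apply/size_poly1P; rewrite size_poly_eq1.
exists (N + q1 * (size u + size v + N))%N => k kk.
pose U := homogenize s k (c^-1%:P * u); pose V := homogenize t k (c^-1%:P * v).
have [M1 U1] := supported_homogenize s k (c^-1%:P * u).
have [M2 V2] := supported_homogenize t k (c^-1%:P * v).
exists U, V, (maxn M1 M2); split.
- exact: supported_in_le (leq_maxl _ _) U1.
- exact: supported_in_le (leq_maxr _ _) V2.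
have c'0 : c^-1 != 0 by rewrite invr_eq0.
apply: fpsP => n; apply: fpsP => m; rewrite !coef_fpsD.
rewrite (homogenizeM _ _ fN fw) ?(homogenizeM _ _ gN gw);
  try by rewrite mul_polyC size_scale //; nia.
rewrite -[ser_Y ^+ k]mulr1 coef_ser_YnM.
case: eqP => w; last first.
  rewrite addr0; case: ltnP => // km; case: n w => [|n] // w.
  by case E: (m - k)%N => [|//]; case: w; rewrite muln0 add0n; congr (_ * _)%N; lia.
rewrite -coefD -!mulrA -mulrDr uvc -polyCM mulVf // coef1.
case: ltnP => km; last by case: n w => [|n] w //; have -> : (m - k = 0)%N by nia.
by case: n w => [|n] // w; nia.
Qed.

End Bezout.

(** * Norms *)

Section Seminorms.
Variable R : realType.

Definition seminorm (A : comNzRingType) (nu : A -> R) :=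
  [/\ forall x, 0 <= nu x, nu 0 = 0, forall x, nu (- x) = nu x,
      forall x y, nu (x + y) <= nu x + nu y
    & forall x y, nu (x * y) <= nu x * nu y].

Lemma le_seminorm_sum (A : comNzRingType) (nu : A -> R) (I : Type) (s : seq I)
    (P : pred I) (F : I -> A) : seminorm nu ->
  nu (\sum_(i <- s | P i) F i) <= \sum_(i <- s | P i) nu (F i).
Proof.
case=> _ nu0 _ nuD _.
apply: (big_ind2 (fun x y => nu x <= y)) => [|x a y b xa yb|//]; first by rewrite nu0.
exact: le_trans (nuD _ _) (lerD xa yb).
Qed.

(** Truncation makes the weighted l1 norm finite on every series and keeps it submultiplicative,
    since coefficients of a product below n involve only coefficients of the factors below n. A
    bound uniform in n then stands for summability. *)
Definition trunc_norm (A : Type) (nu : A -> R) r n (f : fps A) : R :=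
  \sum_(i < n) nu (f i) * r ^+ i.

(** The left side is the part i + j < n of the sum over the square. *)
Lemma triangle_sum_le (a b : nat -> R) n :
  (forall i, 0 <= a i) -> (forall i, 0 <= b i) ->
  \sum_(m < n) \sum_(i < m.+1) a i * b (m - i)%N <=
  (\sum_(i < n) a i) * (\sum_(i < n) b i).
Proof.
move=> a0 b0; rewrite mulr_suml.
have -> : \sum_(m < n) \sum_(i < m.+1) a i * b (m - i)%N =
    \sum_(m < n) \sum_(i < n) if (i <= m)%N then a i * b (m - i)%N else 0.
  apply: eq_bigr => m _.
  rewrite (big_ord_widen n (fun i => a i * b (m - i)%N)) //.
  by rewrite big_mkcond.
rewrite exchange_big; apply: ler_sum => i _.
rewrite -big_mkcond /= -mulr_sumr; apply: ler_wpM2l => //.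
have -> : \sum_(m < n | (i <= m)%N) b (m - i)%N = \sum_(j < n - i) b j.
  rewrite -(big_mkord (fun m => (i <= m)%N) (fun m => b (m - i)%N)).
  rewrite -(big_mkord xpredT b).
  have -> : \sum_(0 <= j < n - i) b j = \sum_(i <= m < n) b (m - i)%N.
    rewrite -{2}[nat_of_ord i]add0n big_addn.
    by apply: eq_bigr => m _; rewrite addnK.
  rewrite (big_cat_nat (n := i)) ?(ltnW (ltn_ord i)) //=.
  rewrite big_nat_cond big1 ?add0r; last by move=> m; lia.
  by rewrite big_nat_cond [RHS]big_nat_cond; apply: eq_bigl => m; lia.
rewrite (big_ord_widen n b) ?leq_subr // big_mkcond /=; apply: ler_sum => j _.
by case: ifP.
Qed.

Lemma trunc_norm_seminorm (A : comNzRingType) (nu : A -> R) r n :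
  0 <= r -> seminorm nu -> seminorm (trunc_norm nu r n).
Proof.
move=> r0 nus; have [nu_ge0 nu0 nuN nuD nuM] := nus.
have rn i : 0 <= r ^+ i by rewrite exprn_ge0.
split=> [f||f|f g|f g].
- by apply: sumr_ge0 => i _; rewrite mulr_ge0.
- by apply: big1 => i _; rewrite nu0 mul0r.
- by apply: eq_bigr => i _; rewrite nuN.
- by rewrite /trunc_norm -big_split /=; apply: ler_sum => i _; rewrite -mulrDl ler_wpM2r.
apply: (le_trans _ (triangle_sum_le (a := fun i => nu (f i) * r ^+ i)
  (b := fun i => nu (g i) * r ^+ i) n _ _)); last 2 first.
- by move=> i; rewrite mulr_ge0.
- by move=> i; rewrite mulr_ge0.
apply: ler_sum => m _; rewrite coef_fpsM.
apply: (le_trans (ler_wpM2r (rn m) (le_seminorm_sum _ _ _ nus))).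
rewrite mulr_suml; apply: ler_sum => i _.
have im : (i <= m)%N by rewrite -ltnS.
by rewrite mulrACA -exprD subnKC // ler_wpM2r.
Qed.

Lemma geometric_half n : \sum_(i < n) (2^-1 : R) ^+ i <= 2.
Proof.
suff -> : \sum_(i < n) (2^-1 : R) ^+ i = 2 - 2 * 2^-1 ^+ n.
  by rewrite gerBl mulr_ge0 // exprn_ge0 // invr_ge0.
by elim: n => [|n IH]; rewrite ?big_ord0 ?big_ord_recr /= ?IH ?expr0 ?exprS; field.
Qed.

Lemma summable_seqP (T : choiceType) (F : T -> R) : (forall x, 0 <= F x) ->
  summable [set: T] (fun x => (F x)%:E) <->
  exists M, forall s : seq T, uniq s -> \sum_(x <- s) F x <= M.
Proof.
move=> F0; split=> [Fs|[M FM]].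
- exists (fine (\esum_(x in [set: T]) `|(F x)%:E|)%E) => s us.
  rewrite -lee_fin fineK; last by rewrite -summableE.
  apply: esum_ge; exists [set` s].
    by split=> //; exact: finite_seq.
  rewrite -fsbig_seq // -sumEFin; apply: lee_sum => x _.
  by rewrite lee_fin /= ger0_norm.
- apply: (@le_lt_trans _ _ M%:E); last exact: ltry.
  apply: ge_ereal_sup => _ [X [finX _] <-].
  rewrite fsbig_finite //=.
  under eq_bigr do rewrite ger0_norm //.
  by rewrite sumEFin lee_fin; apply: FM; exact: finmap.fset_uniq.
Qed.

Lemma le_sum_subset (T : eqType) (F : T -> R) (s t : seq T) :
  (forall x, 0 <= F x) -> uniq s -> uniq t -> {subset s <= t} ->
  \sum_(x <- s) F x <= \sum_(x <- t) F x.
Proof.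
move=> F0 us ut st.
have p : perm_eq s [seq x <- t | x \in s].
  apply: uniq_perm => //; first exact: filter_uniq.
  by move=> x; rewrite mem_filter; case xs: (x \in s) => //=; rewrite st.
rewrite (perm_big _ p) big_filter big_mkcond; apply: ler_sum => x _.
by case: ifP.
Qed.

End Seminorms.

Section Norms.
Variable R : realType.
Local Notation C := R[i].
Implicit Types (f g h : fps2 C) (l : fps C) (r s M : R).

Definition modulus (z : C) : R := complex.Re `|z|.

Lemma modulus_def z : (modulus z)%:C%C = `|z|.
Proof. by rewrite RRe_real // normr_real. Qed.

Lemma modulus_ge0 z : 0 <= modulus z.
Proof. by rewrite -lecR modulus_def normr_ge0. Qed.

Lemma modulusM z w : modulus (z * w) = modulus z * modulus w.
Proof. by apply: (@complexI R); rewrite rmorphM /= !modulus_def normrM. Qed.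

Lemma modulusX z n : modulus (z ^+ n) = modulus z ^+ n.
Proof. by apply: (@complexI R); rewrite rmorphXn /= !modulus_def normrX. Qed.

Lemma modulusV z : modulus z^-1 = (modulus z)^-1.
Proof. by apply: (@complexI R); rewrite fmorphV /= !modulus_def normfV. Qed.

Lemma modulus_nat n : modulus n%:R = n%:R.
Proof. by apply: (@complexI R); rewrite rmorph_nat modulus_def normr_nat. Qed.

Lemma modulus_real (x : R) : 0 <= x -> modulus x%:C%C = x.
Proof. by move=> x0; apply: (@complexI R); rewrite modulus_def ger0_norm ?lecR. Qed.

Lemma modulus_gt0 z : (0 < modulus z) = (z != 0).
Proof. by rewrite -ltcR modulus_def normr_gt0. Qed.

Lemma modulus_seminorm : seminorm modulus.
Proof.
split=> [z||z|z w|z w]; first exact: modulus_ge0.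
- by rewrite /modulus normr0.
- by rewrite /modulus normrN.
- by rewrite -lecR rmorphD /= !modulus_def ler_normD.
- by rewrite modulusM.
Qed.

Lemma modulus0 : modulus 0 = 0.
Proof. by case: modulus_seminorm. Qed.

Definition norm1 r n : fps C -> R := trunc_norm modulus r n.
Definition norm2 r n : fps2 C -> R := trunc_norm (norm1 r n) r n.

Lemma norm2E r n f :
  norm2 r n f = \sum_(i < n) \sum_(j < n) modulus (f i j) * r ^+ (i + j).
Proof.
apply: eq_bigr => i _; rewrite mulr_suml; apply: eq_bigr => j _.
by rewrite -mulrA -exprD addnC.
Qed.

Lemma norm2_seminorm r n : 0 <= r -> seminorm (norm2 r n).
Proof.
by move=> r0; do 2!apply: trunc_norm_seminorm => //; exact: modulus_seminorm.
Qed.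

Definition bounded r M f := forall n, norm2 r n f <= M.

Lemma bounded_ge0 r M f : bounded r M f -> 0 <= M.
Proof. by move/(_ 0%N); rewrite norm2E big_ord0. Qed.

Lemma coef_bounded r M f i j : 0 <= r -> bounded r M f ->
  modulus (f i j) * r ^+ (i + j) <= M.
Proof.
move=> r0 /(_ (i + j).+1); apply: le_trans; rewrite norm2E.
have ii : (i < (i + j).+1)%N by rewrite ltnS leq_addr.
have jj : (j < (i + j).+1)%N by rewrite ltnS leq_addl.
have F0 a b : 0 <= modulus (f a b) * r ^+ (a + b).
  by rewrite mulr_ge0 ?modulus_ge0 ?exprn_ge0.
rewrite (bigD1 (Ordinal ii)) //= (bigD1 (Ordinal jj)) //= -addrA lerDl.
by rewrite addr_ge0 ?sumr_ge0 // => a _; rewrite ?sumr_ge0.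
Qed.

Lemma le_bounded r M M' f : M <= M' -> bounded r M f -> bounded r M' f.
Proof. by move=> MM' fM n; exact: le_trans (fM n) MM'. Qed.

Lemma bounded_const r (z : C) : 0 <= r -> bounded r (modulus z) (ser_const z).
Proof.
move=> r0 n; have m0 := modulus0.
case: n => [|n]; first by rewrite norm2E big_ord0 modulus_ge0.
rewrite norm2E big_ord_recl [X in X + _]big_ord_recl mulr1.
rewrite [X in _ + X + _]big1 => [|j _]; last by rewrite m0 mul0r.
by rewrite big1 ?addr0 // => i _; rewrite big1 // => j _; rewrite m0 mul0r.
Qed.

Lemma boundedD r M M' f g : 0 <= r ->
  bounded r M f -> bounded r M' g -> bounded r (M + M') (f + g).
Proof.
move=> r0 fM gM n; have [_ _ _ nD _] := norm2_seminorm n r0.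
exact: le_trans (nD _ _) (lerD _ _).
Qed.

Lemma boundedN r M f : 0 <= r -> bounded r M f -> bounded r M (- f).
Proof. by move=> r0 fM n; have [_ _ -> _ _] := norm2_seminorm n r0. Qed.

Lemma boundedM r M M' f g : 0 <= r ->
  bounded r M f -> bounded r M' g -> bounded r (M * M') (f * g).
Proof.
move=> r0 fM gM n; have [n0 _ _ _ nM] := norm2_seminorm n r0.
exact: le_trans (nM _ _) (ler_pM _ _ _ _).
Qed.

Lemma bounded_coefwise r s c M f g : 0 <= c ->
  (forall i j, modulus (g i j) * s ^+ (i + j) <=
     c * (modulus (f i j) * r ^+ (i + j))) ->
  bounded r M f -> bounded s (c * M) g.
Proof.
move=> c0 gf fM n; apply: (le_trans _ (ler_wpM2l c0 (fM n))).
rewrite !norm2E mulr_sumr; apply: ler_sum => i _.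
by rewrite mulr_sumr; apply: ler_sum => j _.
Qed.

Lemma bounded_radius r s M f : 0 <= s -> s <= r -> bounded r M f -> bounded s M f.
Proof.
move=> s0 sr; rewrite -{2}[M]mul1r; apply: bounded_coefwise => // i j.
rewrite mul1r ler_wpM2l ?modulus_ge0 // lerXn2r // nnegrE.
exact: le_trans sr.
Qed.

Lemma bounded_swap r M f : bounded r M f -> bounded r M (ser_swap f).
Proof.
move=> fM n; apply: le_trans (fM n); rewrite !norm2E exchange_big /=.
by under eq_bigr do under eq_bigr do rewrite addnC.
Qed.

Lemma bounded_drop r M k f : 0 < r -> bounded r M f ->
  bounded r ((r ^+ k)^-1 * M) (fps_drop k f).
Proof.
move=> r0 fM n; have rk : 0 < r ^+ k by rewrite exprn_gt0.
rewrite mulrC ler_pdivlMr //; apply: le_trans (fM (k + n)%N).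
have F0 a b : 0 <= modulus (f a b) * r ^+ (a + b).
  by rewrite mulr_ge0 ?modulus_ge0 ?exprn_ge0 // ltW.
rewrite !norm2E big_split_ord /= mulr_suml.
apply: (@le_trans _ _ (\sum_(i < n) \sum_(j < k + n)
    modulus (f (k + i)%N j) * r ^+ (k + i + j))); last first.
  by rewrite lerDr; apply: sumr_ge0 => i _; apply: sumr_ge0.
apply: ler_sum => i _; rewrite mulr_suml.
rewrite (big_ord_widen (k + n)
  (fun j => modulus (f (k + i)%N j) * r ^+ (i + j) * r ^+ k)) ?leq_addl //.
rewrite big_mkcond; apply: ler_sum => j _; case: ifP => // _.
by rewrite -mulrA -exprD [(i + j + k)%N]addnC addnA.
Qed.

Lemma bounded_supported N f : supported_in N f -> forall r, 0 <= r ->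
  exists M, bounded r M f.
Proof.
move=> fN r r0; exists (norm2 r N f) => n.
pose t i j := modulus (f i j) * r ^+ (i + j); pose m := maxn n N.
have F0 a b : 0 <= t a b.
  by rewrite mulr_ge0 ?modulus_ge0 ?exprn_ge0.
have F00 i j : (N <= i)%N || (N <= j)%N -> t i j = 0.
  by move=> ij; rewrite /t fN // modulus0 mul0r.
rewrite !norm2E.
apply: (@le_trans _ _ (\sum_(i < m) \sum_(j < m) t i j)).
  rewrite (big_ord_widen m (fun i => \sum_(j < n) t i j)) ?leq_maxl //.
  rewrite big_mkcond; apply: ler_sum => i _.
  apply: (@le_trans _ _ (\sum_(j < n) t i j)).
    by case: ifP => // _; exact: sumr_ge0.
  rewrite (big_ord_widen m (fun j => t i j)) ?leq_maxl //.
  by rewrite big_mkcond; apply: ler_sum => j _; case: ifP.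
rewrite [leRHS](big_ord_widen m (fun i => \sum_(j < N) t i j)) ?leq_maxr //.
rewrite [leRHS]big_mkcond; apply: ler_sum => i _; case: ltnP => iN; last first.
  by rewrite big1 // => j _; rewrite F00 ?iN.
rewrite [leRHS](big_ord_widen m (fun j => t i j)) ?leq_maxr //.
rewrite [leRHS]big_mkcond; apply: ler_sum => j _; case: ltnP => // jN.
by rewrite F00 // jN orbT.
Qed.

(** Any finite set of exponents lies in a square, so it is enough to bound the truncated norms. *)
Lemma convergent2P f : convergent2 f <-> exists r M, 0 < r /\ bounded r M f.
Proof.
split.
- case=> r r0 /summable_seqP [|M fM].
    by move=> x; rewrite mulr_ge0 ?modulus_ge0 ?exprn_ge0 // ltW.
  exists r, M; split=> // n.
  have := fM (allpairs pair (iota 0 n) (iota 0 n)).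
  rewrite big_allpairs allpairs_uniq ?iota_uniq //; last by move=> [? ?] [? ?].
  move=> /(_ isT); apply: le_trans; rewrite norm2E.
  have -> : iota 0 n = index_iota 0 n by rewrite /index_iota subn0.
  rewrite big_mkord; apply: ler_sum => i _.
  by rewrite big_mkord; apply: ler_sum.
- move=> [r [M [r0 fM]]]; exists r => //.
  have F0 (x : nat * nat) : 0 <= modulus (f x.1 x.2) * r ^+ (x.1 + x.2).
    by rewrite mulr_ge0 ?modulus_ge0 ?exprn_ge0 // ltW.
  apply/(summable_seqP (F := fun x : nat * nat => modulus (f x.1 x.2) * r ^+ (x.1 + x.2))) => //.
  exists M => s us; pose n := (\max_(x <- s) maxn x.1 x.2).+1.
  apply: le_trans (fM n).
  apply: le_trans
    (le_sum_subset (t := allpairs pair (iota 0 n) (iota 0 n)) F0 us _ _) _.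
  + by rewrite allpairs_uniq ?iota_uniq // => -[? ?] [? ?].
  + move=> [a b] xs; apply: allpairs_f; rewrite mem_iota /= add0n ltnS.
      exact: leq_trans (leq_maxl a b) (leq_bigmax_seq (F := fun x => maxn x.1 x.2) (a, b) xs isT).
    exact: leq_trans (leq_maxr a b) (leq_bigmax_seq (F := fun x => maxn x.1 x.2) (a, b) xs isT).
  rewrite big_allpairs norm2E.
  have -> : iota 0 n = index_iota 0 n by rewrite /index_iota subn0.
  rewrite big_mkord; apply: ler_sum => i _.
  by rewrite big_mkord; apply: ler_sum.
Qed.

Lemma convergent1P l : convergent1 l <->
  exists rho M, 0 < rho /\ forall n, modulus (l n) <= M * rho ^+ n.
Proof.
split.
- case=> r r0 /summable_seqP [|M lM].
    by move=> x; rewrite mulr_ge0 ?modulus_ge0 ?exprn_ge0 // ltW.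
  exists r^-1, M; rewrite invr_gt0; split=> // n.
  rewrite exprVn ler_pdivlMr ?exprn_gt0 //.
  by have := lM [:: n] isT; rewrite big_seq1.
(* Half the radius suggested by the growth bound leaves a geometric series of ratio 1/2. *)
- move=> [rho [M [rho0 lM]]]; exists (2 * rho)^-1; first by rewrite invr_gt0 mulr_gt0.
  have M0 : 0 <= M by have := lM 0%N; rewrite expr0 mulr1; apply: le_trans (modulus_ge0 _).
  have F0 n : 0 <= modulus (l n) * (2 * rho)^-1 ^+ n.
    by rewrite mulr_ge0 ?modulus_ge0 ?exprn_ge0 // invr_ge0 mulr_ge0 // ltW.
  apply/(summable_seqP (F := fun n => modulus (l n) * (2 * rho)^-1 ^+ n)) => //.
  exists (M * 2) => s us; pose n := (\max_(x <- s) x).+1.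
  apply: le_trans (le_sum_subset (t := iota 0 n) F0 us (iota_uniq _ _) _) _.
    move=> a xs; rewrite mem_iota /= add0n ltnS.
    exact: (leq_bigmax_seq (F := id) a xs isT).
  have -> : iota 0 n = index_iota 0 n by rewrite /index_iota subn0.
  rewrite big_mkord; apply: le_trans (ler_wpM2l M0 (geometric_half _ n)).
  rewrite mulr_sumr; apply: ler_sum => i _.
  apply: le_trans (ler_wpM2r _ (lM i)) _.
    by rewrite exprn_ge0 // invr_ge0 mulr_ge0 // ltW.
  by rewrite -mulrA -exprMn invfM mulrCA mulfV ?mulr1 // gt_eqF.
Qed.

(** The term h^n u_n has norm at most M (eta c)^n, hence at most M 2^-n, and these sum to at most 2
    M. *)
Lemma bounded_hsum r M c eta h (u : nat -> fps2 C) : 0 <= r -> 0 <= M -> 0 <= c ->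
  h 0%N 0%N = 0 -> bounded r eta h -> eta * c <= 2^-1 ->
  (forall n, bounded r (M * c ^+ n) (u n)) -> bounded r (M * 2) (hsum h u).
Proof.
move=> r0 M0 c0 h0 hM etac uM n.
have [nn0 n0 nN nD nM] := norm2_seminorm n r0.
(* Exponents i, j < n have i + j < n + n, so this finite sum has the same truncated norm. *)
pose v := \sum_(m < n + n) h ^+ m * u m.
have -> : norm2 r n (hsum h u) = norm2 r n v.
  rewrite !norm2E; apply: eq_bigr => i _; apply: eq_bigr => j _.
  rewrite (@coef_hsum _ _ _ (n + n)) ?coef_fps_sum //.
  by rewrite -addnS leq_add // ltnW.
have eta0 := bounded_ge0 hM.
apply: le_trans (le_seminorm_sum _ _ _ (norm2_seminorm n r0)) _.
apply: le_trans (ler_wpM2l M0 (geometric_half _ (n + n))).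
rewrite mulr_sumr; apply: ler_sum => m _.
have hm : bounded r (eta ^+ m) (h ^+ m).
  elim: (m : nat) => [|k IH]; last by rewrite !exprS; exact: boundedM.
  by have := bounded_const 1 r0; rewrite [modulus 1](modulus_nat 1).
apply: le_trans (boundedM r0 hm (uM m) n) _.
by rewrite mulrCA -exprMn ler_wpM2l // lerXn2r // nnegrE ?mulr_ge0 //.
Qed.

End Norms.

(** * Operators bounded on a polydisc of fixed radius *)

Section BoundedOperators.
Variables (R : realType) (r : R).
Local Notation C := R[i].
Hypothesis r_gt0 : 0 < r.
Let r_ge0 : 0 <= r := ltW r_gt0.
Implicit Types (f g : fps2 C) (S T : fps2 C -> fps2 C).

(** One constant for all series and no loss of radius: this is what gives iterates a geometric
    bound. A bare derivative is not bounded in this sense. *)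
Definition bounded_op T := exists2 c : R, 0 <= c &
  forall M f, bounded r M f -> bounded r (c * M) (T f).

Lemma bounded_op_comp S T :
  bounded_op S -> bounded_op T -> bounded_op (fun f => S (T f)).
Proof.
move=> [c c0 Sc] [c' c'0 Tc]; exists (c * c'); first exact: mulr_ge0.
by move=> M f fM; rewrite -mulrA; apply/Sc/Tc.
Qed.

Lemma bounded_opD S T :
  bounded_op S -> bounded_op T -> bounded_op (fun f => S f + T f).
Proof.
move=> [c c0 Sc] [c' c'0 Tc]; exists (c + c'); first exact: addr_ge0.
by move=> M f fM; rewrite mulrDl; apply: boundedD => //; [exact: Sc|exact: Tc].
Qed.

Lemma bounded_opN T : bounded_op T -> bounded_op (fun f => - T f).
Proof. by move=> [c c0 Tc]; exists c => // M f /Tc; exact: boundedN. Qed.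

Lemma bounded_op_sum (I : Type) (s : seq I) (T : I -> fps2 C -> fps2 C) :
  (forall i, bounded_op (T i)) -> bounded_op (fun f => \sum_(i <- s) T i f).
Proof.
move=> Tb; elim: s => [|i s [c c0 IH]].
  exists 0 => // M f _; rewrite mul0r big_nil.
  by have := bounded_const 0 r_ge0; rewrite modulus0 ser_const0.
have [c' c'0 Tc] := Tb i; exists (c' + c); first exact: addr_ge0.
move=> M f fM; rewrite mulrDl big_cons.
by apply: boundedD => //; [exact: Tc|exact: IH].
Qed.

Lemma bounded_opM M g T :
  bounded r M g -> bounded_op T -> bounded_op (fun f => g * T f).
Proof.
move=> gM [c c0 Tc]; exists (M * c); first by rewrite mulr_ge0 // (bounded_ge0 gM).
by move=> M' f fM; rewrite -mulrA; apply: boundedM => //; exact: Tc.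
Qed.

Lemma bounded_op_coefwise (c : R) T : 0 <= c ->
  (forall f i j, modulus (T f i j) <= c * modulus (f i j)) -> bounded_op T.
Proof.
move=> c0 Tc; exists c => // M f; apply: bounded_coefwise => // i j.
by rewrite mulrA ler_wpM2r // exprn_ge0.
Qed.

Lemma bounded_op_coef i j : bounded_op (fun f => ser_const (f i j)).
Proof.
exists (r ^+ (i + j))^-1; first by rewrite invr_ge0 exprn_ge0.
move=> M f fM; apply: (@le_bounded _ _ (modulus (f i j))); last exact: bounded_const.
by rewrite mulrC ler_pdivlMr ?exprn_gt0 //; exact: coef_bounded.
Qed.

Lemma bounded_op_drop k : bounded_op (@fps_drop (fps C) k).
Proof.
exists (r ^+ k)^-1; first by rewrite invr_ge0 exprn_ge0.
by move=> M f; exact: bounded_drop.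
Qed.

Lemma bounded_op_swap : bounded_op (@ser_swap C).
Proof. by exists 1 => // M f; rewrite mul1r; exact: bounded_swap. Qed.

Section Weights.
Variables (p1 p2 : nat).
Hypotheses (p1_gt0 : (0 < p1)%N) (p2_gt0 : (0 < p2)%N).

Lemma bounded_op_winv c : bounded_op (@winv C p1 p2 c).
Proof.
apply: (@bounded_op_coefwise 1) => // f i j /=.
rewrite modulusM modulusV modulus_nat ler_wpM2r ?modulus_ge0 //.
(* A weight equal to 0 is inverted to 0, so the bound 1 holds there as well. *)
case: (_ + c)%N => [|n]; first by rewrite invr0.
by rewrite invf_le1 ?ltr0n // ler1n.
Qed.

(** The factor i of the derivative is absorbed, since i <= p1 i + p2 j + c; what remains is a shift
    in x. *)
Lemma bounded_op_ser_x_winv c : bounded_op (fun f => ser_x (@winv C p1 p2 c f)).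
Proof.
pose T f : fps2 C := Fps (fun i => Fps (fun j => i%:R * winv p1 p2 c f i j)).
have Tb : bounded_op T.
  apply: (@bounded_op_coefwise 1) => // f i j /=.
  rewrite mulrA !modulusM modulusV !modulus_nat ler_wpM2r ?modulus_ge0 //.
  case: i => [|i]; first by rewrite mul0r.
  rewrite ler_pdivrMr ?mul1r ?ler_nat ?ltr0n; clear -p1_gt0; nia.
have := bounded_op_comp (bounded_op_drop 1) Tb.
have -> // : (fun f => fps_drop 1 (T f)) = (fun f => ser_x (winv p1 p2 c f)).
apply/funext => f; apply: fpsP => i; apply: fpsP => j.
by rewrite [RHS]/= coef_fpsMn /= mulr_natl.
Qed.

Lemma bounded_op_ser_y_winv c : bounded_op (fun f => ser_y (@winv C p1 p2 c f)).
Proof.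
pose T f : fps2 C := Fps (fun i => Fps (fun j => j%:R * winv p1 p2 c f i j)).
have Tb : bounded_op T.
  apply: (@bounded_op_coefwise 1) => // f i j /=.
  rewrite mulrA !modulusM modulusV !modulus_nat ler_wpM2r ?modulus_ge0 //.
  case: j => [|j]; first by rewrite mul0r.
  rewrite ler_pdivrMr ?mul1r ?ler_nat ?ltr0n; clear -p2_gt0; nia.
have := bounded_op_comp bounded_op_swap (bounded_op_comp (bounded_op_drop 1)
  (bounded_op_comp bounded_op_swap Tb)).
have -> // : (fun f => ser_swap (fps_drop 1 (ser_swap (T f)))) =
  (fun f => ser_y (winv p1 p2 c f)).
apply/funext => f; apply: fpsP => i; apply: fpsP => j.
by rewrite /= mulr_natl.
Qed.

End Weights.

End BoundedOperators.

(** * The convergent rings *)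

Section ConvergentRings.
Variable R : realType.
Local Notation C := R[i].
Implicit Types (f g h : fps2 C) (l m : fps C) (r M : R).

Lemma convergent2_common_radius (s : seq (fps2 C)) :
  (forall f, f \in s -> convergent2 f) ->
  exists2 r : R, 0 < r & forall f, f \in s -> exists M, bounded r M f.
Proof.
elim: s => [_|f s IH sc]; first by exists 1.
have [|r r0 sr] := IH; first by move=> g gs; apply: sc; rewrite inE gs orbT.
have /convergent2P[t [M [t0 ft]]] : convergent2 f by apply: sc; rewrite inE eqxx.
exists (Num.min r t); first by rewrite lt_min r0.
have m0 : 0 <= Num.min r t by rewrite le_min !ltW.
move=> g; rewrite inE => /predU1P[->|/sr[M' gM]].
  by exists M; apply: bounded_radius ft => //; rewrite ge_min lexx orbT.
by exists M'; apply: bounded_radius gM => //; rewrite ge_min lexx.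
Qed.

Lemma convergent2_common_radius2 f g : convergent2 f -> convergent2 g ->
  exists r M M', [/\ 0 < r, bounded r M f & bounded r M' g].
Proof.
move=> fc gc; have [|r r0 fg] := @convergent2_common_radius [:: f; g].
  by move=> k; rewrite !inE => /orP[/eqP->|/eqP->].
have [|M fM] := fg f; first by rewrite inE eqxx.
have [|M' gM] := fg g; first by rewrite !inE eqxx orbT.
by exists r, M, M'.
Qed.

Lemma convergent2D f g : convergent2 f -> convergent2 g -> convergent2 (f + g).
Proof.
move=> fc gc; have [r [M [M' [r0 fM gM]]]] := convergent2_common_radius2 fc gc.
by apply/convergent2P; exists r, (M + M'); split=> //; apply: boundedD => //; exact: ltW.
Qed.

Lemma convergent2M f g : convergent2 f -> convergent2 g -> convergent2 (f * g).
Proof.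
move=> fc gc; have [r [M [M' [r0 fM gM]]]] := convergent2_common_radius2 fc gc.
by apply/convergent2P; exists r, (M * M'); split=> //; apply: boundedM => //; exact: ltW.
Qed.

Lemma convergent2_op (T : fps2 C -> fps2 C) f :
  (forall r, 0 < r -> bounded_op r T) -> convergent2 f -> convergent2 (T f).
Proof.
move=> Tb /convergent2P[r [M [r0 fM]]]; have [c _ Tc] := Tb r r0.
by apply/convergent2P; exists r, (c * M); split=> //; exact: Tc.
Qed.

Lemma convergent2_supported N f : supported_in N f -> convergent2 f.
Proof.
move=> fN; have [M fM] := bounded_supported fN ler01.
by apply/convergent2P; exists 1, M.
Qed.

Lemma convergent2_swap f : convergent2 f -> convergent2 (ser_swap f).
Proof. by apply: convergent2_op => r r0; exact: bounded_op_swap. Qed.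

Lemma convergent2_ser_x f : convergent2 f -> convergent2 (ser_x f).
Proof.
move=> /convergent2P[r [M [r0 fM]]].
pose g : fps2 C := Fps (fun i => Fps (fun j => i%:R * f i j)).
have -> : ser_x f = fps_drop 1 g.
  by apply: fpsP => i; apply: fpsP => j; rewrite /= coef_fpsMn mulr_natl.
apply: (convergent2_op (T := @fps_drop (fps C) 1)) => [t t0|]; first exact: bounded_op_drop.
(* Halving the radius pays for the factor i of the derivative, as i <= 2^(i + j). *)
apply/convergent2P; exists (r / 2), (1 * M); split; first by rewrite divr_gt0.
apply: bounded_coefwise fM => // i j.
rewrite /= modulusM modulus_nat exprMn mul1r.
have -> : i%:R * modulus (f i j) * (r ^+ (i + j) * 2^-1 ^+ (i + j)) =
  i%:R * 2^-1 ^+ (i + j) * (modulus (f i j) * r ^+ (i + j)) by ring.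
rewrite ler_piMl ?mulr_ge0 ?modulus_ge0 ?exprn_ge0 ?(ltW r0) //.
rewrite exprVn ler_pdivrMr ?exprn_gt0 // mul1r -natrX ler_nat.
by apply: (leq_trans (ltnW (ltn_expl i (ltnSn 1)))); rewrite leq_pexp2l ?leq_addr.
Qed.

Lemma convergent2_ser_y f : convergent2 f -> convergent2 (ser_y f).
Proof.
move=> fc; have -> : ser_y f = ser_swap (ser_x (ser_swap f)).
  by apply: fpsP => i; apply: fpsP => j; rewrite /= coef_fpsMn.
exact/convergent2_swap/convergent2_ser_x/convergent2_swap.
Qed.

(** Without constant term, h has a bound that shrinks at least as fast as the radius. *)
Lemma shrink_radius r M c h : 0 < r -> 0 <= c -> h 0%N 0%N = 0 -> bounded r M h ->
  exists s eta, [/\ 0 < s, s <= r, bounded s eta h & eta * c <= 2^-1].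
Proof.
move=> r0 c0 h0 hM; have M0 := bounded_ge0 hM.
have Mc0 : 0 <= M * c by exact: mulr_ge0.
(* Chosen so that t M c <= 1/2; the summand 1 ensures t <= 1 and covers M c = 0. *)
pose t := (1 + 2 * (M * c))^-1.
have t0 : 0 < t by rewrite invr_gt0; lra.
have t1 : t <= 1 by rewrite invf_le1; lra.
exists (t * r), (t * M); split; first exact: mulr_gt0.
- by rewrite ger_pMl.
- apply: bounded_coefwise hM; first exact: ltW.
  move=> i j; rewrite exprMn.
  case: (posnP (i + j)%N) => [|ij].
    by move/eqP; rewrite addn_eq0 => /andP[/eqP-> /eqP->]; rewrite h0 modulus0 !(mul0r, mulr0).
  rewrite mulrCA ler_wpM2r ?mulr_ge0 ?modulus_ge0 ?exprn_ge0 ?(ltW r0) //.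
  by rewrite -(prednK ij) exprS ger_pMr // exprn_ile1 // ltW.
- rewrite -mulrA /t mulrC ler_pdivrMr; lra.
Qed.

Lemma convergent1B l m : convergent1 l -> convergent1 m -> convergent1 (l - m).
Proof.
move=> /convergent1P[a [M [a0 lM]]] /convergent1P[b [M' [b0 mM]]].
have M0 : 0 <= M by have := lM 0%N; rewrite mulr1; apply: le_trans (modulus_ge0 _).
have M'0 : 0 <= M' by have := mM 0%N; rewrite mulr1; apply: le_trans (modulus_ge0 _).
apply/convergent1P; exists (a + b), (M + M'); split=> [|n]; first exact: addr_gt0.
have [_ _ mN mD _] := @modulus_seminorm R.
apply: le_trans (mD _ _) _; rewrite mN mulrDl; apply: lerD.
  by apply: le_trans (lM n) _; rewrite ler_wpM2l // lerXn2r ?nnegrE //; lra.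
by apply: le_trans (mM n) _; rewrite ler_wpM2l // lerXn2r ?nnegrE //; lra.
Qed.

Lemma convergent1M l m : convergent1 l -> convergent1 m -> convergent1 (l * m).
Proof.
move=> /convergent1P[a [M [a0 lM]]] /convergent1P[b [M' [b0 mM]]].
have M0 : 0 <= M by have := lM 0%N; rewrite mulr1; apply: le_trans (modulus_ge0 _).
have M'0 : 0 <= M' by have := mM 0%N; rewrite mulr1; apply: le_trans (modulus_ge0 _).
have ab0 : 0 <= a + b by lra.
(* Each of the n + 1 terms is at most M M' (a + b)^n, and the factor 2^n absorbs their number. *)
apply/convergent1P; exists (2 * (a + b)), (M * M'); split=> [|n]; first lra.
rewrite coef_fpsM; apply: le_trans (le_seminorm_sum _ _ _ (@modulus_seminorm R)) _.
apply: (@le_trans _ _ (\sum_(i < n.+1) M * M' * (a + b) ^+ n)).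
  apply: ler_sum => i _; have im : (i <= n)%N by rewrite -ltnS.
  have -> : (a + b) ^+ n = (a + b) ^+ i * (a + b) ^+ (n - i) by rewrite -exprD subnKC.
  rewrite modulusM mulrACA.
  apply: ler_pM; rewrite ?modulus_ge0 //.
    by apply: le_trans (lM i) _; rewrite ler_wpM2l // lerXn2r ?nnegrE //; lra.
  by apply: le_trans (mM _) _; rewrite ler_wpM2l // lerXn2r ?nnegrE //; lra.
rewrite sumr_const card_ord -[leLHS]mulr_natl exprMn [leRHS]mulrCA.
rewrite ler_wpM2r ?mulr_ge0 ?exprn_ge0 //.
by rewrite -natrX ler_nat ltn_expl.
Qed.

Lemma convergent1_drop k l : convergent1 l -> convergent1 (fps_drop k l).
Proof.
move=> /convergent1P[a [M [a0 lM]]]; apply/convergent1P; exists a, (M * a ^+ k).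
by split=> // n; rewrite -mulrA -exprD; exact: lM.
Qed.

Lemma convergent1_const (z : C) : convergent1 (fps_const z).
Proof.
apply/convergent1P; exists 1, (modulus z); split=> // -[|n] /=.
  by rewrite mulr1.
by rewrite modulus0 expr1n mulr1 modulus_ge0.
Qed.

Lemma convergent2_comp l h :
  h 0%N 0%N = 0 -> convergent2 h -> convergent1 l -> convergent2 (ser_comp l h).
Proof.
move=> h0 /convergent2P[r [M [r0 hM]]] /convergent1P[a [M' [a0 lM]]].
have M'0 : 0 <= M' by have := lM 0%N; rewrite mulr1; apply: le_trans (modulus_ge0 _).
have [s [eta [s0 _ hs etaa]]] := shrink_radius r0 (ltW a0) h0 hM.
apply/convergent2P; exists s, (M' * 2); split=> //; rewrite ser_comp_hsum.
apply: (bounded_hsum (ltW s0) M'0 (ltW a0) h0 hs etaa) => n.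
exact: le_bounded (lM n) (bounded_const _ (ltW s0)).
Qed.

Lemma has_weightX (p1 p2 d n : nat) h :
  (forall i j, h i j != 0 -> (p1 * i + p2 * j)%N = d) ->
  forall i j, (h ^+ n) i j != 0 -> (p1 * i + p2 * j)%N = (n * d)%N.
Proof.
move=> wh; elim: n => [[|i] [|j]|n IH i j] /=; rewrite ?eqxx ?muln0 //.
move=> hn; apply/eqP; apply: contraNT hn => w.
rewrite exprS coef_fps2M big1 // => a _; rewrite big1 // => b _; apply/eqP.
apply: contraNT w; rewrite mulf_eq0 negb_or => /andP[/wh wa /IH wb].
have ai : (a <= i)%N by rewrite -ltnS.
have bj : (b <= j)%N by rewrite -ltnS.
have := congr1 (muln p1) (subnKC ai); have := congr1 (muln p2) (subnKC bj).
by rewrite !mulnDr mulSn; lia.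
Qed.

(* If z x^a y^b is the lexicographically first monomial of h, then that of h^n is
   z^n x^(na) y^(nb), and by weight no other power of h contains it. *)
Lemma convergent1_of_comp (p1 p2 d : nat) l h : (0 < d)%N ->
  (forall i j, (p1 * i + p2 * j)%:R * h i j = d%:R * h i j) ->
  (exists i j, h i j != 0) -> convergent2 (ser_comp l h) -> convergent1 l.
Proof.
move=> d0 wh [i0 [j0 hij]] /convergent2P[r [M [r0 lM]]].
have exa : exists i, h i != 0.
  by exists i0; apply: contra_neq hij => ->.
case: (ex_minnP exa) => a ha amin.
have exb : exists j, h a j != 0.
  apply: contrapT => hab; move/eqP: ha; apply; apply: fpsP => j.
  by apply/eqP; rewrite -[_ == _]negbK; apply/negP => ?; apply: hab; exists j.
case: (ex_minnP exb) => b hb bmin.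
have lowa i : (i < a)%N -> h i = 0.
  by move=> ia; apply/eqP; apply: contraTT ia => /amin; rewrite -leqNgt.
have lowb j : (j < b)%N -> h a j = 0.
  by move=> jb; apply/eqP; apply: contraTT jb => /bmin; rewrite -leqNgt.
have wh' i j : h i j != 0 -> (p1 * i + p2 * j)%N = d.
  by move=> /mulIf/(_ _ _ (wh i j))/eqP; rewrite eqr_nat => /eqP.
have wab := wh' _ _ hb.
have coefn n : (h ^+ n) (n * a)%N (n * b)%N = h a b ^+ n.
  have [-> _] := coef_exp_low n lowa.
  by have [-> _] := coef_exp_low n lowb.
have lcoef n : ser_comp l h (n * a)%N (n * b)%N = l n * h a b ^+ n.
  rewrite coef_ser_comp.
  (* The weight d is positive, so a + b > 0 and h^n does occur in the truncated sum defining this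
     coefficient. *)
  have nn : (n < (n * a + n * b).+1)%N.
    have : (0 < a + b)%N by move: wab d0; clear; nia.
    by rewrite ltnS -mulnDr => ?; apply: leq_pmulr.
  rewrite (bigD1 (Ordinal nn)) //= coefn big1 ?addr0 // => m mn.
  have [->|/(has_weightX wh')] := eqVneq ((h ^+ m) (n * a)%N (n * b)%N) 0.
    by rewrite mulr0.
  have -> : (p1 * (n * a) + p2 * (n * b) = n * d)%N by rewrite -wab; ring.
  by move/eqP; rewrite eqn_pmul2r // => /eqP nm; case/eqP: mn; exact: val_inj.
(* The Cauchy estimate for the coefficient l_n z^n at x^(na) y^(nb), with z = [h a b], bounds l_n by
   M times the nth power of the inverse of this number. *)
have z0 : 0 < modulus (h a b) * r ^+ (a + b) by rewrite mulr_gt0 ?modulus_gt0 ?exprn_gt0.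
apply/convergent1P; exists (modulus (h a b) * r ^+ (a + b))^-1, M.
rewrite invr_gt0; split=> // n.
rewrite exprVn ler_pdivlMr ?exprn_gt0 // exprMn mulrA -modulusX -modulusM -lcoef.
rewrite -exprM mulnDl ![(_ * n)%N]mulnC; exact: coef_bounded (ltW r0) lM.
Qed.

End ConvergentRings.

(** * The division operators *)

Section Division.
Variables (R : realType).
Local Notation C := R[i].
Variables (p1 p2 d : nat) (H : fps2 C).
Hypotheses (p1_gt0 : (0 < p1)%N) (p2_gt0 : (0 < p2)%N) (d_gt0 : (0 < d)%N).
Hypothesis weight_H :
  forall i j, (p1 * i + p2 * j)%:R * H i j = d%:R * H i j.
Variables (N : nat) (a1 b1 a2 b2 : fps2 C).
Hypothesis XnE : ser_X ^+ N = a1 * ser_x H + b1 * ser_y H.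
Hypothesis YnE : ser_Y ^+ N = a2 * ser_x H + b2 * ser_y H.
Variables (mu : nat) (a : 'I_mu -> fps2 C).
Variables (z : nat -> nat -> 'I_mu -> C) (b c : nat -> nat -> fps2 C).
Hypothesis monomialE : forall i j, ser_X ^+ i * ser_Y ^+ j =
  \sum_k ser_const (z i j k) * a k + (b i j * ser_x H + c i j * ser_y H).
Implicit Types f g : fps2 C.

Let low f : fps2 C := Fps (fun i => if (i < N)%N then f i else 0).
(** The part of f with i < N and j >= N, divided by y^N; [low] removes the monomials already
    accounted for by x^N. *)
Let drop_y f : fps2 C := ser_swap (fps_drop N (ser_swap (low f))).

Lemma monomial_split f :
  f = \sum_(i < N) \sum_(j < N) ser_const (f i j) * (ser_X ^+ i * ser_Y ^+ j) +
      (ser_X ^+ N * fps_drop N f + ser_Y ^+ N * drop_y f).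
Proof.
apply: fpsP => p; apply: fpsP => q.
rewrite !coef_fpsD coef_ser_XnM coef_ser_YnM !coef_fps_sum.
have -> : \sum_(i < N) (\sum_(j < N)
    ser_const (f i j) * (ser_X ^+ i * ser_Y ^+ j)) p q =
    \sum_(i < N) \sum_(j < N) f i j * ((p == i :> nat) && (q == j :> nat))%:R.
  apply: eq_bigr => i _; rewrite !coef_fps_sum; apply: eq_bigr => j _.
  by rewrite coef_ser_constM coef_monomial.
rewrite -[drop_y f p _]/((if (p < N)%N then f p else 0) (N + (q - N))%N).
have [pN|pN] := ltnP p N; last first.
  rewrite big1 ?add0r => [|i _]; last first.
    by rewrite big1 // => j _; rewrite gtn_eqF ?mulr0 //; exact: leq_trans pN.
  by rewrite -[fps_drop N f _ q]/(f (N + (p - N))%N q) subnKC // if_same addr0.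
rewrite (bigD1 (Ordinal pN)) //= [X in _ + X + _]big1 ?addr0 ?add0r; last first.
  move=> i /negPf ip; rewrite big1 // => j _; rewrite [p == i]eq_sym.
  by rewrite [_ == _](_ : _ = (i == Ordinal pN)) // ip mulr0.
have [qN|qN] := ltnP q N; last first.
  rewrite big1 ?add0r => [|j _]; first by rewrite subnKC.
  by rewrite [q == j]gtn_eqF ?andbF ?mulr0 //; exact: leq_trans qN.
rewrite (bigD1 (Ordinal qN)) //= big1 ?addr0 ?eqxx ?mulr1 // => j /negPf jq.
by rewrite [q == j]eq_sym [_ == _](_ : _ = (j == Ordinal qN)) // jq andbF mulr0.
Qed.

(* Monomials with i, j < N are divided by monomialE, all others through x^N and
   y^N: finitely many quotients suffice to bound these operators. *)
Definition residue k f : C := \sum_(i < N) \sum_(j < N) f i j * z i j k.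
Definition quot_x f : fps2 C :=
  \sum_(i < N) \sum_(j < N) ser_const (f i j) * b i j +
  (a1 * fps_drop N f + a2 * drop_y f).
Definition quot_y f : fps2 C :=
  \sum_(i < N) \sum_(j < N) ser_const (f i j) * c i j +
  (b1 * fps_drop N f + b2 * drop_y f).

Lemma divisionE f : f = \sum_k ser_const (residue k f) * a k +
  (quot_x f * ser_x H + quot_y f * ser_y H).
Proof.
rewrite {1}(monomial_split f) XnE YnE.
have -> : \sum_(i < N) \sum_(j < N) ser_const (f i j) * (ser_X ^+ i * ser_Y ^+ j) =
  \sum_k ser_const (residue k f) * a k +
  ((\sum_(i < N) \sum_(j < N) ser_const (f i j) * b i j) * ser_x H +
   (\sum_(i < N) \sum_(j < N) ser_const (f i j) * c i j) * ser_y H).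
  have -> : \sum_k ser_const (residue k f) * a k =
      \sum_(i < N) \sum_(j < N) ser_const (f i j) * \sum_k ser_const (z i j k) * a k.
    transitivity (\sum_k \sum_(i < N) \sum_(j < N)
        ser_const (f i j) * (ser_const (z i j k) * a k)).
      apply: eq_bigr => k _; rewrite /residue ser_const_sum mulr_suml.
      apply: eq_bigr => i _; rewrite ser_const_sum mulr_suml.
      by apply: eq_bigr => j _; rewrite ser_constM mulrA.
    rewrite exchange_big; apply: eq_bigr => i _.
    rewrite exchange_big; apply: eq_bigr => j _.
    by rewrite mulr_sumr.
  rewrite !mulr_suml -!big_split; apply: eq_bigr => i _ /=.
  rewrite !mulr_suml -!big_split; apply: eq_bigr => j _ /=.
  by rewrite monomialE !mulrDr !mulrA.
rewrite /quot_x /quot_y; ring.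
Qed.

(** This and [h_quot] are the Hamiltonian and the cofactor of h that [jacobian_split] extracts from
    the Jacobian part of [divisionE]. *)
Definition potential f : fps2 C :=
  p1%:R * (ser_X * winv p1 p2 p1 (quot_y f)) -
  p2%:R * (ser_Y * winv p1 p2 p2 (quot_x f)).
Definition h_quot f : fps2 C :=
  d%:R * (ser_x (winv p1 p2 p2 (quot_x f)) + ser_y (winv p1 p2 p1 (quot_y f))).

Lemma cokernel_step f : f = \sum_k ser_const (residue k f) * a k +
  (ham H (potential f) + H * h_quot f).
Proof.
rewrite {1}(divisionE f); congr (_ + _).
exact: (jacobian_split p1_gt0 p2_gt0 weight_H).
Qed.

(** The nth iterate of [h_quot] is what is left of f after n divisions, with h^n in front; its
    residues are the coefficients of h^n. *)
Definition cokernel_coord k f : fps C :=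
  Fps (fun n => residue k (iter n h_quot f)).
Definition cokernel_potential f : fps2 C :=
  hsum H (fun n => potential (iter n h_quot f)).

Lemma cokernel_spanning f :
  f = \sum_k ser_comp (cokernel_coord k f) H * a k + ham H (cokernel_potential f).
Proof.
have H0 := weight_H00 d_gt0 weight_H.
apply/eqP; rewrite -subr_eq0; apply/eqP.
apply: (hadic_ind (s := h_quot) (E := fun f => f - (\sum_k ser_comp (cokernel_coord k f) H * a k
  + ham H (cokernel_potential f))) H0) => {}f.
have coordE k : fps_drop 1 (cokernel_coord k f) = cokernel_coord k (h_quot f).
  by apply: fpsP => n; rewrite -[RHS]/(residue k (iter n h_quot (h_quot f))) -iterSr.
have potE : cokernel_potential f = potential f + H * cokernel_potential (h_quot f).
  have shiftE : (fun n => potential (iter n h_quot (h_quot f))) =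
      (fun n => potential (iter n.+1 h_quot f)).
    by apply/funext => n; rewrite iterSr.
  have recE := hsum_rec (fun n => potential (iter n h_quot f)) H0.
  apply: (etrans recE).
  exact: (congr1 (fun u => potential f + H * hsum H u) (esym shiftE)).
have hamE : ham H (cokernel_potential f) =
    ham H (potential f) + H * ham H (cokernel_potential (h_quot f)).
  by rewrite {1}potE hamD hamM ham_H mul0r add0r.
have sumE : \sum_k ser_comp (cokernel_coord k f) H * a k =
    \sum_k ser_const (residue k f) * a k +
    H * \sum_k ser_comp (cokernel_coord k (h_quot f)) H * a k.
  rewrite mulr_sumr -big_split; apply: eq_bigr => k _.
  by rewrite (ser_comp_rec _ H0) coordE mulrDl mulrA.
have alg (e S T s0 s1 g q t : fps2 C) : e = s0 + (g + H * q) ->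
    S = s0 + H * s1 -> T = g + H * t -> e - (S + T) = H * (q - (s1 + t)).
  by move=> -> -> ->; ring.
exact: alg (cokernel_step f) sumE hamE.
Qed.

Hypotheses (H_supp : exists M, supported_in M H)
  (a1_supp : exists M, supported_in M a1) (b1_supp : exists M, supported_in M b1)
  (a2_supp : exists M, supported_in M a2) (b2_supp : exists M, supported_in M b2).
Hypotheses (b_conv : forall i j, convergent2 (b i j))
  (c_conv : forall i j, convergent2 (c i j)).

(** Only the finitely many [e i j] with i, j < N occur, and polynomial cofactors are bounded at any
    radius, so the [e i j] alone restrict r. *)
Lemma bounded_op_quot r (e : nat -> nat -> fps2 C) (u v : fps2 C) : 0 < r ->
  (forall i j, (i < N)%N -> (j < N)%N -> exists M, bounded r M (e i j)) ->
  (exists M, supported_in M u) -> (exists M, supported_in M v) ->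
  bounded_op r (fun f => \sum_(i < N) \sum_(j < N) ser_const (f i j) * e i j +
    (u * fps_drop N f + v * drop_y f)).
Proof.
move=> r0 eM [M1 /bounded_supported/(_ r (ltW r0))[M1' uM]].
move=> [M2 /bounded_supported/(_ r (ltW r0))[M2' vM]].
have low_b : bounded_op r low.
  apply: (bounded_op_coefwise r0 (c := 1)) => // f i j /=; rewrite mul1r.
  by case: ifP => // _; rewrite modulus0 modulus_ge0.
apply: (bounded_opD r0).
  apply: (bounded_op_sum r0) => i; apply: (bounded_op_sum r0) => j.
  have [M eij] := eM i j (ltn_ord i) (ltn_ord j).
  have -> : (fun f => ser_const (f i j) * e i j) = (fun f => e i j * ser_const (f i j)).
    by apply/funext => f; rewrite mulrC.
  exact: (bounded_opM r0 eij (bounded_op_coef r0 i j)).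
apply: (bounded_opD r0).
  exact: (bounded_opM r0 uM (bounded_op_drop r0 N)).
apply: (bounded_opM r0 vM).
apply: (bounded_op_comp (bounded_op_swap _)).
apply: (bounded_op_comp (bounded_op_drop r0 N)).
exact: (bounded_op_comp (bounded_op_swap _) low_b).
Qed.

Lemma cokernel_convergent f : convergent2 f ->
  (forall k, convergent1 (cokernel_coord k f)) /\ convergent2 (cokernel_potential f).
Proof.
move=> fc; have [M0 /convergent2_supported Hc] := H_supp.
(* One radius serves f, h and the finitely many quotients of monomials; all operators below are
   bounded there. *)
have [|r r0 rb] := @convergent2_common_radius R
  (f :: H :: [seq b i j | i <- iota 0 N, j <- iota 0 N] ++
    [seq c i j | i <- iota 0 N, j <- iota 0 N]).
  move=> g; rewrite !inE mem_cat => /or3P[/eqP->//|/eqP->//|].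
  by case/orP=> /allpairsP[[i j] [_ _ ->]].
have bM i j : (i < N)%N -> (j < N)%N -> exists M, bounded r M (b i j).
  by move=> iN jN; apply: rb; rewrite !inE mem_cat allpairs_f ?mem_iota ?orbT.
have cM i j : (i < N)%N -> (j < N)%N -> exists M, bounded r M (c i j).
  by move=> iN jN; apply: rb; rewrite !inE mem_cat (allpairs_f c) ?mem_iota ?orbT.
have [|M fM] := rb f; first by rewrite inE eqxx.
have [|MH HM] := rb H; first by rewrite !inE eqxx orbT.
have qx : bounded_op r quot_x := bounded_op_quot r0 bM a1_supp a2_supp.
have qy : bounded_op r quot_y := bounded_op_quot r0 cM b1_supp b2_supp.
have natM n : bounded r (modulus n%:R) (n%:R : fps2 C).
  have := bounded_const (n%:R : C) (ltW r0).
  by rewrite ser_const_nat.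
have [MX XM] : exists M, bounded r M (ser_X : fps2 C).
  apply: (bounded_supported (N := 2)) (ltW r0) => -[|[|i]] [|[|j]] //=.
have [MY YM] : exists M, bounded r M (ser_Y : fps2 C).
  apply: (bounded_supported (N := 2)) (ltW r0) => -[|[|i]] [|[|j]] //=.
have [cP cP0 Pb] : bounded_op r h_quot.
  apply: (bounded_opM r0 (natM d)); apply: (bounded_opD r0).
    exact: (bounded_op_comp (bounded_op_ser_x_winv r0 p2 p1_gt0 p2) qx).
  exact: (bounded_op_comp (bounded_op_ser_y_winv r0 p1 p2_gt0 p1) qy).
have [cG cG0 Gb] : bounded_op r potential.
  apply: (bounded_opD r0).
    apply: (bounded_opM r0 (natM p1)); apply: (bounded_opM r0 XM).
    exact: (bounded_op_comp (bounded_op_winv r0 p1 p2 p1) qy).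
  apply: (bounded_opN r0).
  apply: (bounded_opM r0 (natM p2)); apply: (bounded_opM r0 YM).
  exact: (bounded_op_comp (bounded_op_winv r0 p1 p2 p2) qx).
have iterM n : bounded r (M * cP ^+ n) (iter n h_quot f).
  elim: n => [|n IH]; first by rewrite mulr1.
  by rewrite exprS mulrCA iterS; exact: Pb.
have M_ge0 := bounded_ge0 fM.
split=> [k|].
  have [ck ck0 kb] : bounded_op r (fun f => ser_const (residue k f)).
    have -> : (fun f => ser_const (residue k f)) = (fun f => \sum_(i < N) \sum_(j < N)
        ser_const (z i j k) * ser_const (f i j)).
      apply/funext => g; rewrite /residue ser_const_sum; apply: eq_bigr => i _.
      by rewrite ser_const_sum; apply: eq_bigr => j _; rewrite ser_constM mulrC.
    apply: (bounded_op_sum r0) => i; apply: (bounded_op_sum r0) => j.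
    exact: (bounded_opM r0 (bounded_const _ (ltW r0)) (bounded_op_coef r0 i j)).
  (* The iterates grow at most like [cP] to the n; the added 1 makes the ratio positive even if [cP]
     is 0. *)
  apply/convergent1P; exists (1 + cP), (ck * M); split=> [|n]; first by rewrite ltr_pwDl.
  have := coef_bounded 0 0 (ltW r0) (kb _ _ (iterM n)).
  rewrite mulr1 mulrA => /le_trans; apply.
  by rewrite ler_wpM2l ?mulr_ge0 // lerXn2r ?nnegrE ?addr_ge0 // lerDr.
have H0 := weight_H00 d_gt0 weight_H.
(* On a smaller polydisc h outweighs the growth of the iterates. *)
have [s [eta [s0 sr Hs etac]]] := shrink_radius r0 cP0 H0 HM.
apply/convergent2P; exists s, (cG * M * 2); split=> //.
apply: (bounded_hsum (ltW s0) _ cP0 H0 Hs etac) => [|n]; first exact: mulr_ge0.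
by rewrite -mulrA; apply: bounded_radius (ltW s0) sr _; apply: Gb.
Qed.

End Division.

(** * Isolated quasi-homogeneous singularities *)

Lemma coef_quasi_homogeneous (K : comNzRingType) (p1 p2 : nat) (delta : K)
    (h : {poly {poly K}}) : quasi_homogeneous p1 p2 delta h ->
  forall i j, (p1 * i + p2 * j)%:R * ser_of_pol h i j = delta * ser_of_pol h i j.
Proof.
move=> qh i j; have := congr1 (fun q : {poly {poly K}} => q`_i`_j) qh.
rewrite coefD !coefMn coefD !coefMn.
have -> : ('X * pol_x h)`_i`_j = h`_i`_j *+ i.
  by rewrite coefXM; case: i => [|i]; rewrite ?coef0 //= coef_deriv coefMn.
have -> : ('X%:P * pol_y h)`_i`_j = h`_i`_j *+ j.
  rewrite coefCM coef_map_id0 ?deriv0 // coefXM.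
  by case: j => [|j]; rewrite //= coef_deriv.
rewrite !coefCM -!mulrnA -mulrnDr => <- /=.
by rewrite mulr_natl [(i * _)%N]mulnC [(j * _)%N]mulnC.
Qed.

Section QuasiHomogeneousSingularity.
Variables (R : realType) (p1 p2 : nat) (delta : R[i]) (h : {poly {poly R[i]}}).
Local Notation C := R[i].
Hypotheses (p1_gt0 : (0 < p1)%N) (p2_gt0 : (0 < p2)%N).
Hypotheses (qh : quasi_homogeneous p1 p2 delta h) (h_isol : isolated_singularity h).
Let H : fps2 C := ser_of_pol h.

(** If h were constant, both partial derivatives would vanish identically and 0 would not be
    isolated. A nonconstant monomial has positive weight, which must be delta. *)
Lemma weighted_degree : exists2 d, (0 < d)%N &
  delta = d%:R /\ exists i j, H i j != 0.
Proof.
have [_ [_ [e e0 isol]]] := h_isol.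
have [i [j [ij Hij]]] : exists i j, ((i != 0) || (j != 0))%N /\ H i j != 0.
  apply: contrapT => nH.
  have H0 i j : ((i != 0) || (j != 0))%N -> H i j = 0.
    by move=> ij; apply/eqP; rewrite -[_ == _]negbK; apply/negP => ?; apply: nH; exists i, j.
  have hx : pol_x h = 0.
    apply/polyP => i; rewrite coef0; apply/polyP => j.
    by rewrite coef0 coef_deriv coefMn -[h`_i.+1`_j]/(H i.+1 j) H0 // mul0rn.
  have hy : pol_y h = 0.
    apply/polyP => i; rewrite coef0; apply/polyP => j.
    by rewrite coef0 coef_map_id0 ?deriv0 // coef_deriv -[h`_i`_j.+1]/(H i j.+1) H0 ?orbT // mul0rn.
  (* A nonzero point of the neighbourhood that would be singular. *)
  have [||||] := isol (e / 2)%:C%C 0; rewrite ?hx ?hy ?horner0 //.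
  - rewrite -/(modulus _) modulus_real; lra.
  - by rewrite normr0.
  - move=> /(congr1 (@complex.Re R)) /= e20 _.
    by move/eqP: e20; rewrite gt_eqF ?divr_gt0.
exists (p1 * i + p2 * j)%N.
  by move: ij; rewrite addn_gt0 !muln_gt0 p1_gt0 p2_gt0 !lt0n.
split; last by exists i, j.
by have /(mulIf Hij) := coef_quasi_homogeneous qh i j.
Qed.

(** The weighted dilations (s^p1 x, s^p2 y) preserve the singular locus, and a small s moves any
    singular point into the given neighbourhood of 0. *)
Lemma global_singularity x y :
  (pol_x h).[x, y] = 0 -> (pol_y h).[x, y] = 0 -> x = 0 /\ y = 0.
Proof.
move=> hx hy; have [_ [_ [e e0 isol]]] := h_isol.
have [d d0 [dE _]] := weighted_degree.
have wH i j : H i j != 0 -> (p1 * i + p2 * j)%N = d.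
  move=> /mulIf/(_ _ _ (coef_quasi_homogeneous qh i j))/eqP.
  by rewrite dE eqr_nat => /eqP.
have [N1 sx] := supported_of_pol (pol_x h).
have [N2 sy] := supported_of_pol (pol_y h).
(* With s = 1/t this gives (|x| + |y|) s < e; the summand 1 yields the strict inequality and s <= 1,
   hence s^p <= s for p > 0. *)
pose t := 1 + (modulus x + modulus y) / e.
have m0 : 0 <= (modulus x + modulus y) / e by rewrite divr_ge0 ?addr_ge0 ?modulus_ge0 ?ltW.
have t1 : 1 <= t by rewrite /t lerDl.
have t0 : 0 < t by lra.
pose s : C := t^-1%:C%C.
have s0 : s != 0 by rewrite /s fmorph_eq0 invr_eq0 gt_eqF.
have small z p : (0 < p)%N -> modulus z <= modulus x + modulus y ->
    complex.Re `|z * s ^+ p| < e.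
  move=> p0 zxy; rewrite -/(modulus _) modulusM modulusX.
  have -> : modulus s = t^-1.
    by rewrite modulus_real // invr_ge0 ltW.
  apply: (@le_lt_trans _ _ ((modulus x + modulus y) * t^-1)).
    apply: ler_pM; rewrite ?modulus_ge0 ?exprn_ge0 ?invr_ge0 ?(ltW t0) //.
    by rewrite -(prednK p0) exprS ger_pMr ?invr_gt0 // exprn_ile1 ?invr_ge0 ?(ltW t0) // invf_le1.
  by rewrite ltr_pdivrMr // /t mulrDr mulr1 mulrC divfK ?gt_eqF // ltrDr.
have [||||sx0 sy0] := isol (x * s ^+ p1) (y * s ^+ p2).
- by apply: small; rewrite // lerDl modulus_ge0.
- by apply: small; rewrite // lerDr modulus_ge0.
- apply: (mulfI (expf_neq0 p1 s0)); rewrite mulr0 -(ser_eval_of_pol _ _ sx).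
  rewrite (@ser_eval_scale _ _ _ p1 p2 _ d) ?(ser_eval_of_pol _ _ sx) ?hx ?mulr0 // => i j.
  by rewrite -ser_x_of_pol /= coef_fpsMn /= mulrn_eq0 /= => /wH <-; rewrite mulnS; lia.
- apply: (mulfI (expf_neq0 p2 s0)); rewrite mulr0 -(ser_eval_of_pol _ _ sy).
  rewrite (@ser_eval_scale _ _ _ p1 p2 _ d) ?(ser_eval_of_pol _ _ sy) ?hy ?mulr0 // => i j.
  by rewrite -ser_y_of_pol /= mulrn_eq0 /= => /wH <-; rewrite mulnS; lia.
by split; [apply/eqP; move/eqP: sx0|apply/eqP; move/eqP: sy0];
  rewrite mulf_eq0 expf_eq0 (negPf s0) andbF orbF.
Qed.

Lemma jacobian_powers : exists N a1 b1 a2 b2,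
  [/\ exists M, supported_in M a1, exists M, supported_in M b1,
      exists M, supported_in M a2 & exists M, supported_in M b2] /\
  ser_X ^+ N = a1 * ser_x H + b1 * ser_y H /\
  ser_Y ^+ N = a2 * ser_x H + b2 * ser_y H.
Proof.
have [d d0 [dE _]] := weighted_degree.
have wH i j : H i j != 0 -> (p1 * i + p2 * j)%N = d.
  move=> /mulIf/(_ _ _ (coef_quasi_homogeneous qh i j))/eqP.
  by rewrite dE eqr_nat => /eqP.
rewrite /H ser_x_of_pol ser_y_of_pol.
set f := ser_of_pol (pol_x h); set g := ser_of_pol (pol_y h).
have wf i j : f i j != 0 -> (p1 * i + p2 * j + p1)%N = d.
  by rewrite /f -ser_x_of_pol /= coef_fpsMn /= mulrn_eq0 /= => /wH <-; rewrite mulnS; lia.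
have wg i j : g i j != 0 -> (p1 * i + p2 * j + p2)%N = d.
  by rewrite /g -ser_y_of_pol /= mulrn_eq0 /= => /wH <-; rewrite mulnS; lia.
have [N1 sf] := supported_of_pol (pol_x h).
have [N2 sg] := supported_of_pol (pol_y h).
pose N := maxn N1 N2.
have fN : supported_in N f by exact: supported_in_le (leq_maxl _ _) sf.
have gN : supported_in N g by exact: supported_in_le (leq_maxr _ _) sg.
have swapN (e : fps2 C) : supported_in N e -> supported_in N (ser_swap e).
  by move=> eN i j; rewrite orbC => /eN.
(* A common zero (a, 1) would be a singular point with nonzero second coordinate. *)
have [k1 Y_in] := homogeneous_bezout p2_gt0 fN gN wf wg (fun a (ha : _ = 0) (hb : _ = 0) =>
  let: conj _ e := global_singularity (etrans (esym (ser_eval_of_pol a 1 fN)) ha)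
    (etrans (esym (ser_eval_of_pol a 1 gN)) hb) in elimN eqP (oner_neq0 C) e).
(* The same with variables and weights exchanged; swapping back turns y^k into x^k. *)
have [k2 X_in] : exists k0, forall k, (k0 <= k)%N -> exists u v M,
    [/\ supported_in M u, supported_in M v &
      ser_Y ^+ k = u * ser_swap f + v * ser_swap g].
  apply: (homogeneous_bezout p1_gt0 (swapN _ fN) (swapN _ gN)
    (s := p1) (t := p2) (q1 := p2) (d := d)).
  - by move=> i j /wf <-; lia.
  - by move=> i j /wg <-; lia.
  move=> a; rewrite !ser_eval_swap !ser_eval_of_pol // => fa ga.
  by have [/eqP] := global_singularity fa ga; rewrite oner_eq0.
have [u [v [M [uM vM Ye]]]] := Y_in _ (leq_maxl k1 k2).
have [u' [v' [M' [u'M v'M Xe]]]] := X_in _ (leq_maxr k1 k2).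
exists (maxn k1 k2), (ser_swap u'), (ser_swap v'), u, v; split.
  split; [exists M' => i j|exists M' => i j|by exists M|by exists M].
    by rewrite orbC => /u'M.
  by rewrite orbC => /v'M.
split; last exact: Ye.
rewrite -ser_swapYn Xe.
have swapE (u0 v0 f0 g0 : fps2 C) :
    ser_swap (u0 * ser_swap f0 + v0 * ser_swap g0) = ser_swap u0 * f0 + ser_swap v0 * g0.
  by rewrite ser_swapD !ser_swapM !ser_swapK.
exact: swapE.
Qed.

End QuasiHomogeneousSingularity.

(** * Kernel and cokernel *)

(* What the proof uses of (C{x,y}, C{t}) and of (C[[x,y]], C[[t]]). *)
Record admissible_pair (R : realType) (p1 p2 : nat) (H : fps2 R[i])
    (A : set (fps2 R[i])) (L : set (fps R[i])) : Prop := AdmissiblePair {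
  adm_D : forall f g, A f -> A g -> A (f + g);
  adm_M : forall f g, A f -> A g -> A (f * g);
  adm_supported : forall N f, supported_in N f -> A f;
  adm_drop : forall k f, A f -> A (fps_drop k f);
  adm_winv : forall c f, A f -> A (winv p1 p2 c f);
  adm_ser_x : forall f, A f -> A (ser_x f);
  adm_ser_y : forall f, A f -> A (ser_y f);
  admL_const : forall z, L (fps_const z);
  admL_B : forall l m, L l -> L m -> L (l - m);
  admL_M : forall l m, L l -> L m -> L (l * m);
  admL_drop : forall k l, L l -> L (fps_drop k l);
  adm_comp : forall l, A (ser_comp l H) <-> L l
}.

Section Assembly.
Variables (R : realType) (p1 p2 d : nat) (h : {poly {poly R[i]}}).
Local Notation C := R[i].
Let H : fps2 C := ser_of_pol h.
Let delta : C := d%:R.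
Hypotheses (p1_gt0 : (0 < p1)%N) (p2_gt0 : (0 < p2)%N) (d_gt0 : (0 < d)%N).
Hypothesis weight_H :
  forall i j, (p1 * i + p2 * j)%:R * H i j = d%:R * H i j.
Variables (N : nat) (a1 b1 a2 b2 : fps2 C).
Hypotheses (a1_supp : exists M, supported_in M a1)
  (b1_supp : exists M, supported_in M b1)
  (a2_supp : exists M, supported_in M a2)
  (b2_supp : exists M, supported_in M b2).
Hypothesis XnE : ser_X ^+ N = a1 * ser_x H + b1 * ser_y H.
Hypothesis YnE : ser_Y ^+ N = a2 * ser_x H + b2 * ser_y H.
Variables (A : set (fps2 C)) (L : set (fps C)).
Hypothesis AL : admissible_pair p1 p2 H A L.
(** The analytic content of the spanning statement: trivial for formal series, and
    [cokernel_convergent] for convergent ones. *)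
Hypothesis spanning_closed : forall (mu : nat) (z : nat -> nat -> 'I_mu -> C)
    (b c : nat -> nat -> fps2 C) f,
  (forall i j, A (b i j)) -> (forall i j, A (c i j)) -> A f ->
  (forall k, L (cokernel_coord p1 p2 d N a1 b1 a2 b2 z b c k f)) /\
  A (cokernel_potential p1 p2 d H N a1 b1 a2 b2 b c f).
Implicit Types (f g : fps2 C) (l m : fps C).

Let H00 : H 0%N 0%N = 0 := weight_H00 d_gt0 weight_H.

Let ring_const z : A (ser_const z).
Proof. by apply: (adm_supported AL (N := 1)) => -[|i] [|j]. Qed.
Let ring_N f : A f -> A (- f).
Proof.
move=> fA; have -> : - f = ser_const (- 1) * f.
  by apply: fpsP => i; apply: fpsP => j; rewrite coef_ser_constM mulN1r.
exact: (adm_M AL (ring_const _) fA).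
Qed.
Let ring_nat n f : A f -> A (n%:R * f).
Proof. by move=> fA; rewrite -ser_const_nat; exact: (adm_M AL (ring_const _) fA). Qed.
Let ring_monomial i j : A (ser_X ^+ i * ser_Y ^+ j).
Proof.
apply: (adm_supported AL (N := (maxn i j).+1)) => p q pq; rewrite coef_monomial.
by case: andP => // -[/eqP ep /eqP eq]; move: pq; rewrite ep eq; lia.
Qed.
Let ring_X f : A f -> A (ser_X * f).
Proof.
move=> fA; apply: (adm_M AL _ fA).
by have := ring_monomial 1 0; rewrite expr1 mulr1.
Qed.
Let ring_Y f : A f -> A (ser_Y * f).
Proof.
move=> fA; apply: (adm_M AL _ fA).
by have := ring_monomial 0 1; rewrite expr1 mul1r.
Qed.
Let ring_supp f : (exists M, supported_in M f) -> A f.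
Proof. by move=> [M /(adm_supported AL)]. Qed.
Let ring_sum (I : Type) (s : seq I) (F : I -> fps2 C) :
  (forall i, A (F i)) -> A (\sum_(i <- s) F i).
Proof.
move=> FA; apply: (big_ind A) => // [|f g]; last exact: (adm_D AL).
by have := ring_const 0; rewrite ser_const0.
Qed.

Let deltaV : ser_const delta^-1 * ser_const delta = 1.
Proof. by rewrite -ser_constM mulVf ?pnatr_eq0 -?lt0n // [LHS]ser_const_nat. Qed.

Let ham_constM z f : ham H (ser_const z * f) = ser_const z * ham H f.
Proof. by rewrite hamM ham_const mul0r add0r. Qed.

Lemma X0E f : X0 h delta f = ser_const delta^-1 * ham H f.
Proof. by rewrite /X0 /ham /H ser_x_of_pol ser_y_of_pol. Qed.

Lemma im_X0P g : im_X0 h delta A g <-> exists2 f, A f & ham H f = g.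
Proof.
split=> [[f fA <-]|[f fA <-]].
  exists (ser_const delta^-1 * f); first exact: (adm_M AL (ring_const _) fA).
  by rewrite ham_constM X0E.
exists (ser_const delta * f); first exact: (adm_M AL (ring_const _) fA).
by rewrite X0E ham_constM mulrA deltaV mul1r.
Qed.

Lemma J0P g : J0 h A g <-> exists b c, [/\ A b, A c & g = b * ser_x H + c * ser_y H].
Proof. by rewrite /J0 /ideal_gen2 /H ser_x_of_pol ser_y_of_pol. Qed.

Lemma J0_D f g : J0 h A f -> J0 h A g -> J0 h A (f + g).
Proof.
move=> /J0P[b [c [bA cA ->]]] /J0P[b' [c' [b'A c'A ->]]]; apply/J0P.
exists (b + b'), (c + c'); split; [exact: (adm_D AL)|exact: (adm_D AL)|ring].
Qed.

Lemma J0_N f : J0 h A f -> J0 h A (- f).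
Proof.
move=> /J0P[b [c [bA cA ->]]]; apply/J0P; exists (- b), (- c).
by split; [exact: ring_N|exact: ring_N|ring].
Qed.

Lemma J0_ham f : A f -> J0 h A (ham H f).
Proof.
move=> fA; apply/J0P; exists (- ser_y f), (ser_x f); split.
- exact/ring_N/(adm_ser_y AL).
- exact: (adm_ser_x AL).
- rewrite /ham; ring.
Qed.

Lemma J0_H f : A f -> J0 h A (H * f).
Proof.
move=> fA; have fA' : A (ser_const delta^-1 * f) by exact: (adm_M AL (ring_const _) fA).
apply/J0P; exists (p1%:R * (ser_X * (ser_const delta^-1 * f))),
  (p2%:R * (ser_Y * (ser_const delta^-1 * f))).
split; [exact/ring_nat/ring_X|exact/ring_nat/ring_Y|].
transitivity ((p1%:R * (ser_X * ser_x H) + p2%:R * (ser_Y * ser_y H)) *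
  (ser_const delta^-1 * f)); last by ring.
rewrite (euler weight_H) -(ser_const_nat C d).
transitivity ((ser_const delta^-1 * ser_const delta) * (H * f)); last by ring.
by rewrite deltaV mul1r.
Qed.

Lemma torsion_free f : A f -> (exists2 g, A g & ham H g = H * f) ->
  exists2 g, A g & ham H g = f.
Proof.
move=> fA [g gA /esym hg].
have e := ham_torsion p1_gt0 d_gt0 weight_H XnE YnE hg.
exists (winv p1 p2 d (fps_drop N (a1 * (d%:R * ser_x g - p2%:R * (ser_Y * f)) +
  b1 * (p1%:R * (ser_X * f) + d%:R * ser_y g)))); last exact: esym e.
apply/(adm_winv AL)/(adm_drop AL)/(adm_D AL).
  apply: (adm_M AL (ring_supp a1_supp)); apply: (adm_D AL).
    exact/ring_nat/(adm_ser_x AL).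
  exact/ring_N/ring_nat/ring_Y.
apply: (adm_M AL (ring_supp b1_supp)); apply: (adm_D AL).
  exact/ring_nat/ring_X.
exact/ring_nat/(adm_ser_y AL).
Qed.

Lemma ker_X0E : ker_X0 h delta A = series_in h L.
Proof.
apply/seteqP; split=> f.
- move=> [fA]; rewrite X0E => e0.
  have {e0} f0 : ham H f = 0.
    by rewrite -[LHS]mul1r -deltaV [ser_const delta^-1 * _]mulrC -mulrA e0 mulr0.
  (* [T] is defined on all series, but controlled only on the kernel of [ham]; elsewhere 0 serves as
     a default. *)
  have /choice[T Tstep] g : exists g', ham H g = 0 ->
      ham H g' = 0 /\ g = ser_const (g 0%N 0%N) + H * g'.
    have [g0|] := pselect (ham H g = 0); last by exists 0.
    by have [g' ? ?] := ham_kernel_step p1_gt0 p2_gt0 d_gt0 weight_H XnE YnE g0; exists g'.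
  pose l g : fps C := Fps (fun n => (iter n T g) 0%N 0%N).
  have lT g : fps_drop 1 (l g) = l (T g).
    by apply: fpsP => n; rewrite -[LHS]/(iter n.+1 T g 0%N 0%N) iterSr.
  have step g : ham H g = 0 -> g - ser_comp (l g) H = H * (T g - ser_comp (l (T g)) H).
    move=> /Tstep[_ e]; rewrite (ser_comp_rec _ H00) lT {1}e.
    rewrite -[l g 0%N]/(g 0%N 0%N).
    have alg (c u v : fps2 C) : c + H * u - (c + H * v) = H * (u - v) by ring.
    exact: alg.
  (* The step needs {h, g} = 0, so divisibility by h^n is proved along the iterates of f, which stay
     in the kernel. *)
  have fl : f - ser_comp (l f) H = 0.
    apply: (eq0_of_divisible H00) => n.
    exists (iter n T f - ser_comp (l (iter n T f)) H).
    have iter0 (m : nat) : ham H (iter m T f) = 0.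
      elim: m => [|m IH]; first exact: f0.
      by have [e _] := Tstep _ IH; exact: e.
    elim: n => [|n ->]; first by rewrite expr0 mul1r.
    rewrite (step _ (iter0 n)) mulrA -exprSr; reflexivity.
  have fE : f = ser_comp (l f) H by apply/eqP; rewrite -subr_eq0 fl.
  by exists (l f); [apply/(adm_comp AL); rewrite -fE|rewrite -/H -fE].
- move=> [l lL <-]; split; first by apply/(adm_comp AL).
  by rewrite X0E (ham_comp d_gt0 weight_H) mulr0.
Qed.

Lemma series_in_subring : subring_closed (mem (series_in h L)).
Proof.
split=> [|f g|f g]; rewrite ?in_setE.
- exists (fps_const 1); first exact: (admL_const AL).
  by rewrite -/H (ser_comp_const _ H00); exact: (ser_const_nat C 1).
- move=> [l lL <-] [m mL <-]; exists (l - m); first exact: (admL_B AL).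
  by rewrite -/H ser_compB.
- move=> [l lL <-] [m mL <-]; exists (l * m); first exact: (admL_M AL).
  by rewrite -/H (ser_compM _ _ H00).
Qed.

Lemma im_X0_submodule : is_submodule (series_in h L) (im_X0 h delta A).
Proof.
split.
- apply/im_X0P; exists 0; first by have := ring_const 0; rewrite ser_const0.
  by rewrite -(ser_const0 C) ham_const ser_const0.
- move=> f g /im_X0P[f' f'A <-] /im_X0P[g' g'A <-]; apply/im_X0P.
  by exists (f' + g'); [exact: (adm_D AL)|rewrite hamD].
- move=> c f [l lL <-] /im_X0P[f' f'A <-]; apply/im_X0P.
  exists (ser_comp l H * f'); first by apply: (adm_M AL _ f'A); apply/(adm_comp AL).
  by rewrite hamM (ham_comp d_gt0 weight_H) mul0r add0r.
Qed.

Section Basis.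
Variables (mu : nat) (a : 'I_mu -> fps2 C).
Hypothesis basis_J0 : quotient_basis A (range (@ser_const C)) (J0 h A) a.

Lemma sum_ser_comp_rec (l : 'I_mu -> fps C) :
  \sum_k ser_comp (l k) H * a k =
  \sum_k ser_const (l k 0%N) * a k + H * \sum_k ser_comp (fps_drop 1 (l k)) H * a k.
Proof.
rewrite mulr_sumr -big_split; apply: eq_bigr => k _.
by rewrite (ser_comp_rec _ H00) mulrDl mulrA.
Qed.

Lemma cokernel_free_step (l : 'I_mu -> fps C) : (forall k, L (l k)) ->
  (exists2 g, A g & ham H g = \sum_k ser_comp (l k) H * a k) ->
  (forall k, l k 0%N = 0) /\
  exists2 g, A g & ham H g = \sum_k ser_comp (fps_drop 1 (l k)) H * a k.
Proof.
have [aA _ indep] := basis_J0; move=> lL [g gA ge].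
have sumA : A (\sum_k ser_comp (fps_drop 1 (l k)) H * a k).
  apply: ring_sum => k; apply: (adm_M AL) => //.
  by apply/(adm_comp AL)/(admL_drop AL).
have sumE := sum_ser_comp_rec l.
have l0 k : l k 0%N = 0.
  have c0 : ser_const (l k 0%N) = 0.
    apply: (indep (fun k => ser_const (l k 0%N))) => [i|]; first by exists (l i 0%N).
    have alg (u v w : fps2 C) : u = v + w -> v = u + - w by move=> ->; ring.
    apply: (eq_ind_r (J0 h A) _ (alg _ _ _ (etrans ge sumE))).
    by apply: J0_D; [exact: J0_ham|apply: J0_N; exact: J0_H].
  exact: (congr1 (fun u : fps2 C => u 0%N 0%N) c0).
split; first exact: l0.
apply: (torsion_free sumA); exists g; first exact: gA.
have s0 : \sum_k ser_const (l k 0%N) * a k = 0.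
  by apply: big1 => k _; rewrite l0 ser_const0 mul0r.
have alg (s u v : fps2 C) : s = 0 -> u = s + v -> u = v by move=> -> ->; rewrite add0r.
exact: alg s0 (etrans ge sumE).
Qed.

(** Each step kills the constant terms and shifts the l_k, so the nth coefficients are reached after
    n steps. *)
Lemma cokernel_free (l : 'I_mu -> fps C) : (forall k, L (l k)) ->
  (exists2 g, A g & ham H g = \sum_k ser_comp (l k) H * a k) ->
  forall k, l k = 0.
Proof.
move=> lL lg k; apply: fpsP => n; move: k.
elim: n l lL lg => [|n IH] l lL /(cokernel_free_step lL)[l0 lg] //.
by apply: IH lg => k; exact: (admL_drop AL).
Qed.

Lemma cokernel_span f : A f -> exists2 c : 'I_mu -> fps2 C,
  (forall k, series_in h L (c k)) & im_X0 h delta A (f - \sum_k c k * a k).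
Proof.
have [aA span _] := basis_J0; move=> fA.
(* The basis property is applied to monomials only and the quotients are chosen once for all, which
   makes the division linear in f. *)
have /choice[D DE] (ij : nat * nat) :
    exists zbc : ('I_mu -> C) * (fps2 C * fps2 C),
    [/\ A zbc.2.1, A zbc.2.2 & ser_X ^+ ij.1 * ser_Y ^+ ij.2 =
      \sum_k ser_const (zbc.1 k) * a k + (zbc.2.1 * ser_x H + zbc.2.2 * ser_y H)].
  have [e eS /J0P[b [c [bA cA e']]]] := span _ (ring_monomial ij.1 ij.2).
  have /choice[z zE] k : exists z, ser_const z = e k by have [z _ <-] := eS k; exists z.
  exists (z, (b, c)); split=> //=; rewrite -e' addrC.
  under eq_bigr => k _ do rewrite zE.
  by rewrite subrK.
pose z i j := (D (i, j)).1; pose b i j := (D (i, j)).2.1; pose c i j := (D (i, j)).2.2.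
have bA i j : A (b i j) by have [] := DE (i, j).
have cA i j : A (c i j) by have [] := DE (i, j).
have zE i j : ser_X ^+ i * ser_Y ^+ j =
    \sum_k ser_const (z i j k) * a k + (b i j * ser_x H + c i j * ser_y H).
  by have [] := DE (i, j).
have [coordL potA] := spanning_closed z bA cA fA.
have fE := cokernel_spanning p1_gt0 p2_gt0 d_gt0 weight_H XnE YnE zE f.
exists (fun k => ser_comp (cokernel_coord p1 p2 d N a1 b1 a2 b2 z b c k f) H).
  by move=> k; exists (cokernel_coord p1 p2 d N a1 b1 a2 b2 z b c k f).
apply/im_X0P; exists (cokernel_potential p1 p2 d H N a1 b1 a2 b2 b c f) => //.
have alg (e S T : fps2 C) : e = S + T -> T = e - S by move=> ->; ring.
exact: alg fE.
Qed.

End Basis.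

Lemma kernel_and_cokernel_admissible : kernel_and_cokernel h delta A L.
Proof.
split; first by split; [exact: ker_X0E|exact: series_in_subring].
move=> mu mu_gt0 a basis_a _; split; first exact: im_X0_submodule.
have [aA _ _] := basis_a; split=> // [f|c cS cI k]; first exact: cokernel_span.
have /choice[l lE] i : exists l, L l /\ ser_comp l H = c i.
  by have [l lL <-] := cS i; exists l.
have -> : c = (fun i => ser_comp (l i) H) by apply/funext => i; have [_ ->] := lE i.
rewrite (cokernel_free basis_a (l := l)) ?ser_comp0 // => [i|]; first by have [] := lE i.
have /im_X0P[g gA ge] := cI; exists g => //; rewrite ge.
by apply: eq_bigr => i _; have [_ ->] := lE i.
Qed.

End Assembly.

Lemma admissible_convergent (R : realType) (p1 p2 d : nat) (H : fps2 R[i]) :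
  (0 < d)%N -> (forall i j, (p1 * i + p2 * j)%:R * H i j = d%:R * H i j) ->
  (exists i j, H i j != 0) -> (exists M, supported_in M H) ->
  admissible_pair p1 p2 H (@convergent2 R) (@convergent1 R).
Proof.
move=> d_gt0 wH H_neq0 [M0 HM0].
have H00 := weight_H00 d_gt0 wH.
split.
- exact: convergent2D.
- exact: convergent2M.
- exact: convergent2_supported.
- move=> k f; apply: (convergent2_op (T := fps_drop k)) => r r0.
  exact: bounded_op_drop.
- move=> c f; apply: (convergent2_op (T := winv p1 p2 c)) => r r0.
  exact: bounded_op_winv.
- exact: convergent2_ser_x.
- exact: convergent2_ser_y.
- exact: convergent1_const.
- exact: convergent1B.
- exact: convergent1M.
- by move=> k l; exact: convergent1_drop.
- move=> l; split; first exact: convergent1_of_comp d_gt0 wH H_neq0.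
  exact: convergent2_comp H00 (convergent2_supported HM0).
Qed.

Theorem mainTheorem5 (R : realType) (p1 p2 : nat) (delta : R[i])
    (h : {poly {poly R[i]}}) :
  (0 < p1)%N -> (0 < p2)%N -> coprime p1 p2 ->
  quasi_homogeneous p1 p2 delta h ->
  isolated_singularity h ->
  kernel_and_cokernel h delta (@convergent2 R) (@convergent1 R) /\
  kernel_and_cokernel h delta [set: fps2 R[i]] [set: fps R[i]].
Proof.
move=> p1_gt0 p2_gt0 _ qh isol.
have [d d_gt0 [dE H_neq0]] := weighted_degree p1_gt0 p2_gt0 qh isol.
have wH i j := coef_quasi_homogeneous qh i j.
have [N [a1 [b1 [a2 [b2 [[a1s b1s a2s b2s] [XnE YnE]]]]]]] :=
  jacobian_powers p1_gt0 p2_gt0 qh isol.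
have Hs := supported_of_pol h.
subst delta; split.
  apply: (kernel_and_cokernel_admissible p1_gt0 p2_gt0 d_gt0 wH a1s b1s XnE YnE).
    exact: admissible_convergent d_gt0 wH H_neq0 Hs.
  move=> mu z b c f bA cA.
  exact: (cokernel_convergent p1_gt0 p2_gt0 d_gt0 wH N z Hs a1s b1s a2s b2s bA cA).
exact: (kernel_and_cokernel_admissible p1_gt0 p2_gt0 d_gt0 wH a1s b1s XnE YnE).
Qed.
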